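(* Let $\mathbb{F}$ be $\mathbb{R}$, $\mathbb{C}$ or $\mathbb{H}$. Let $V$ be a real algebraic variety and let $X \subseteq V$ be a compact locally contractible subset. Then there exists a stratification $\mathcal{S}$ of $V$ such that, for each positive integer $n$, every continuous map from $X$ into $\mathbb{G}(\mathbb{F}^n)$ can be approximated by piecewise $\mathcal{S}$-regular maps; that is, for every continuous map $f\colon X \to \mathbb{G}(\mathbb{F}^n)$, every neighborhood of $f$ in $\mathcal{C}(X,\mathbb{G}(\mathbb{F}^n))$ contains a piecewise $\mathcal{S}$-regular map.
   Context: A real algebraic variety is a locally ringed space isomorphic to an algebraic subset of $\mathbb{R}^m$ (for some $m$) endowed with the Zariski topology and the sheaf of real-valued regular functions (functions locally of the form $P/Q$ with $P,Q$ polynomials, $Q$ nowhere zero). Morphisms of real algebraic varieties are called regular maps. Each real algebraic variety also carries the Euclidean topology; all topological notions (compact, locally contractible, continuous, connected component, ...) refer to the Euclidean topology unless ''Zariski'' is specified. Regular map on a subset: let $V,W$ be real algebraic varieties, $X\subseteq V$ any subset, $Z$ the Zariski closure of $X$ in $V$. A map $f\colon X\to W$ is regular if there exist a Zariski open neighborhood $Z_0\subseteq Z$ of $X$ and a regular map $\tilde f\colon Z_0\to W$ with $\tilde f|_X=f$. A stratification of $V$ is a finite collection of pairwise disjoint Zariski locally closed subvarieties of $V$ (some possibly empty) whose union is $V$. A continuous map $f\colon X\to W$ is piecewise $\mathcal{S}$-regular, for a stratification $\mathcal{S}$ of $V$, if for every $S\in\mathcal{S}$ the restriction of $f$ to each connected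 component of $X\cap S$ is a regular map. $\mathcal{C}(X,W)$ is the space of continuous maps from $X$ into $W$ with the compact-open topology. $\mathbb{F}$-vector spaces are left vector spaces ($\mathbb{H}$ denotes the quaternions). $\mathbb{G}_r(\mathbb{F}^n)$ is the Grassmannian of $r$-dimensional $\mathbb{F}$-vector subspaces of $\mathbb{F}^n$, regarded as a real algebraic variety in the standard way (e.g. identifying a subspace with the matrix of the orthogonal projection onto it), and $\mathbb{G}(\mathbb{F}^n)=\coprod_{r=0}^n\mathbb{G}_r(\mathbb{F}^n)$ is the disjoint union, also a real algebraic variety. *)

(* Defs.v *)
From HB Require Import structures.
From mathcomp Require Import all_boot all_order all_algebra.
From mathcomp Require Import ring.
From mathcomp Require Import all_classical all_reals all_analysis.
From mathcomp Require Import complex.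
From mathcomp Require mpoly.

Set Implicit Arguments.
Unset Strict Implicit.
Unset Printing Implicit Defensive.

Import Order.TTheory GRing.Theory Num.Theory.
Import numFieldNormedType.Exports.

Local Open Scope classical_set_scope.
Local Open Scope ring_scope.

(* Spaces carrying a Zariski topology and a sheaf of real-valued functions.
   Sections over U are represented by total functions of which only the values
   on U matter, and only Zariski open U matter.  No axiom is imposed here: the
   predicate [real_algebraic_variety] pins the structure down up to
   isomorphism. *)
Record fspace (R : realType) := FSpace {
  point :> Type;
  zopen : set (set point);
  regfun : set point -> set (point -> R) }.

Section FunctionSpaces.
Variable R : realType.
Implicit Types S T : fspace R.

HB.instance Definition _ S := gen_eqMixin (point S).
HB.instance Definition _ S := gen_choiceMixin (point S).

(* The Euclidean topology: the coarsest topology making every global regular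
   function continuous.  For an algebraic subset of R^m it is the subspace
   topology, because the coordinates are regular and regular functions are
   continuous; being defined from the regular functions only, it is transported
   by isomorphisms. *)
HB.instance Definition _ S := isSubBaseTopological.Build (point S)
  [set U | exists (f : point S -> R) (O : set R),
     [/\ regfun setT f, open O & U = f @^-1` O]] id.

Definition zclosed S (A : set S) := zopen (~` A).

Definition zclosure S (A : set S) : set S :=
  \bigcap_(Z in [set Z | zclosed Z /\ A `<=` Z]) Z.

Definition zlocally_closed S (A : set S) :=
  exists U Z, [/\ zopen U, zclosed Z & A = U `&` Z].

(* Structure induced on a subset: the trace topology, and functions that are
   locally restrictions of sections of S. *)
Definition subfspace S (Y : set S) : fspace R := @FSpace R Y
  [set U | exists2 O, zopen O & U = set_val @^-1` O]
  (fun U => [set f | forall x : Y, U x ->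
     exists O g, [/\ zopen O, O (set_val x), regfun O g &
       forall y : Y, U y -> O (set_val y) -> f y = g (set_val y)]]).

Definition morphism S T (f : S -> T) :=
  forall U, zopen U -> zopen (f @^-1` U) /\
    forall g, regfun U g -> regfun (f @^-1` U) (g \o f).

Definition isomorphic S T := exists (f : S -> T) (g : T -> S),
  [/\ cancel f g, cancel g f, morphism f & morphism g].

Definition algebraic m (A : set 'rV[R]_m) :=
  exists I : set (mpoly.mpoly m R),
    A = [set x | forall p, I p -> mpoly.meval (x 0) p = 0].

Definition affine_space m : fspace R := @FSpace R 'rV[R]_m
  [set U | algebraic (~` U)]
  (fun U => [set f | forall x, U x ->
     exists N (p q : mpoly.mpoly m R), [/\ algebraic (~` N), N x &
       forall y, N y -> U y -> mpoly.meval (y 0) q != 0 /\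
         f y = mpoly.meval (y 0) p / mpoly.meval (y 0) q]]).

Definition real_algebraic_variety S :=
  exists m (A : set (affine_space m)),
    algebraic A /\ isomorphic S (subfspace A).

(* [f : X -> W] extends to a regular map on a Zariski open neighbourhood Z0 of X
   in the Zariski closure of X. *)
Definition regular_map_on S T (X : set S) (f : X -> T) :=
  exists (U : set S) (Z0 := zclosure X `&` U) (F : subfspace Z0 -> T),
    [/\ zopen U, X `<=` Z0, morphism F &
      forall (x : X) (z : Z0), set_val z = set_val x -> F z = f x].

Definition restrict (D C : Type) (X Y : set D) (YX : Y `<=` X) (f : X -> C) :
    Y -> C :=
  fun y => f (SigSub (mem_set (YX _ (set_valP y)))).

Definition stratification S (strata : set (set S)) :=
  [/\ finite_set strata, forall A, strata A -> zlocally_closed A,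
      trivIset strata id & \bigcup_(A in strata) A = setT].

Definition component_subl S (X A : set S) (x : S) :
    connected_component (X `&` A) x `<=` X :=
  subset_trans (@connected_component_sub _ _ _) (@subIsetl _ _ _).

(* The connected components of X `&` A are the [connected_component (X `&` A) x]
   for x in X `&` A. *)
Definition piecewise_regular S T (strata : set (set S)) (X : set S)
    (f : X -> T) :=
  continuous f /\
  forall A, strata A -> forall x, (X `&` A) x ->
    regular_map_on (restrict (@component_subl S X A x) f).

End FunctionSpaces.

Arguments affine_space : clear implicits.

(* The space C(X, W) with the compact-open topology. *)
Definition cmaps (X W : topologicalType) : topologicalType :=
  initial_topology
    (fun f : continuousType X W => (f : X -> W) : {compact-open, X -> W}).

(* Local contractibility in the sense of Borsuk: every neighbourhood U of a point
   contains a neighbourhood N which is contractible in U. *)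
Definition locally_contractible (R : realType) (T : topologicalType) :=
  forall (x : T) (U : set T), nbhs x U ->
    exists N : set T, [/\ nbhs x N, N `<=` U &
      exists (H : T * R -> T) (c : T),
        [/\ {within N `*` [set` `[0, 1]], continuous H},
            forall y, N y -> H (y, 0) = y,
            forall y, N y -> H (y, 1) = c &
            forall y t, N y -> 0 <= t <= 1 -> U (H (y, t))]].

Record quaternion (R : Type) := Quaternion { qre : R; qi : R; qj : R; qk : R }.

Section Quaternions.
Variable R : comNzRingType.
Local Notation H := (quaternion R).

Definition tuple_of_quat (x : H) := (qre x, qi x, qj x, qk x).
Definition quat_of_tuple (x : R * R * R * R) : H :=
  let: (a, b, c, d) := x in Quaternion a b c d.
Lemma tuple_of_quatK : cancel tuple_of_quat quat_of_tuple.
Proof. by case. Qed.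

HB.instance Definition _ := Choice.copy H (can_type tuple_of_quatK).

Definition quat_add (x y : H) :=
  Quaternion (qre x + qre y) (qi x + qi y) (qj x + qj y) (qk x + qk y).
Definition quat_opp (x : H) :=
  Quaternion (- qre x) (- qi x) (- qj x) (- qk x).
Definition quat_mul (x y : H) := Quaternion
  (qre x * qre y - qi x * qi y - qj x * qj y - qk x * qk y)
  (qre x * qi y + qi x * qre y + qj x * qk y - qk x * qj y)
  (qre x * qj y - qi x * qk y + qj x * qre y + qk x * qi y)
  (qre x * qk y + qi x * qj y - qj x * qi y + qk x * qre y).
Definition quat_conj (x : H) := Quaternion (qre x) (- qi x) (- qj x) (- qk x).

Lemma quat_addA : associative quat_add.
Proof. by move=> x y z; rewrite /quat_add /= !addrA. Qed.
Lemma quat_addC : commutative quat_add.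
Proof. by move=> x y; congr Quaternion; apply: addrC. Qed.
Lemma quat_add0 : left_id (Quaternion 0 0 0 0) quat_add.
Proof. by case=> *; rewrite /quat_add /= !add0r. Qed.
Lemma quat_addN : left_inverse (Quaternion 0 0 0 0) quat_opp quat_add.
Proof. by case=> *; rewrite /quat_add /= !addNr. Qed.

HB.instance Definition _ :=
  GRing.isZmodule.Build H quat_addA quat_addC quat_add0 quat_addN.

Lemma quat_mulA : associative quat_mul.
Proof. by move=> x y z; rewrite /quat_mul /=; congr Quaternion; ring. Qed.
Lemma quat_mul1l : left_id (Quaternion 1 0 0 0) quat_mul.
Proof. by case=> *; rewrite /quat_mul /=; congr Quaternion; ring. Qed.
Lemma quat_mul1r : right_id (Quaternion 1 0 0 0) quat_mul.
Proof. by case=> *; rewrite /quat_mul /=; congr Quaternion; ring. Qed.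
Lemma quat_mulDl : left_distributive quat_mul +%R.
Proof. by move=> x y z; rewrite /quat_mul /=; congr Quaternion; rewrite /=; ring. Qed.
Lemma quat_mulDr : right_distributive quat_mul +%R.
Proof. by move=> x y z; rewrite /quat_mul /=; congr Quaternion; rewrite /=; ring. Qed.
Lemma quat_1neq0 : Quaternion 1 0 0 0 != 0 :> H.
Proof. by apply/eqP => -[] /eqP; rewrite oner_eq0. Qed.

HB.instance Definition _ := GRing.Zmodule_isNzRing.Build H
  quat_mulA quat_mul1l quat_mul1r quat_mulDl quat_mulDr quat_1neq0.

End Quaternions.

Variant base_field := BaseR | BaseC | BaseH.

Section Grassmannians.
Variables (R : realType) (k : base_field).

Definition scalar : nzRingType :=
  match k with
  | BaseR => R : nzRingType
  | BaseC => R[i] : nzRingType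
  | BaseH => quaternion R : nzRingType
  end.

Definition real_dim : nat :=
  match k with BaseR => 1%N | BaseC => 2%N | BaseH => 4%N end.

Definition real_coords : scalar -> seq R :=
  match k return match k with
    | BaseR => R : nzRingType
    | BaseC => R[i] : nzRingType
    | BaseH => quaternion R : nzRingType
    end -> seq R with
  | BaseR => fun x => [:: x]
  | BaseC => fun x => [:: complex.Re x; complex.Im x]
  | BaseH => fun x => [:: qre x; qi x; qj x; qk x]
  end.

Definition scalar_conj : scalar -> scalar :=
  match k return match k with
    | BaseR => R : nzRingType
    | BaseC => R[i] : nzRingType
    | BaseH => quaternion R : nzRingType
    end -> match k with
    | BaseR => R : nzRingType
    | BaseC => R[i] : nzRingType
    | BaseH => quaternion R : nzRingType
    end with
  | BaseR => id
  | BaseC => @conjc R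
  | BaseH => @quat_conj R
  end.

Variable n : nat.

Definition hermitian (x y : 'rV[scalar]_n) : scalar :=
  \sum_i x 0 i * scalar_conj (y 0 i).

(* U is an r-dimensional left vector subspace of F^n: it consists of the left
   linear combinations of r left linearly independent vectors, the rows of B. *)
Definition subspace_of_dim r (U : set 'rV[scalar]_n) :=
  exists B : 'M[scalar]_(r, n),
    (forall c : 'rV_r, c *m B = 0 -> c = 0) /\
    U = range (fun c : 'rV_r => c *m B).

(* Vectors are rows, so that left linear endomorphisms are x |-> x *m P. *)
Definition orthogonal_projection (U : set 'rV[scalar]_n) (P : 'M[scalar]_n) :=
  forall x, U (x *m P) /\ forall u, U u -> hermitian (x - x *m P) u = 0.

Definition realify (P : 'M[scalar]_n) : 'rV[R]_(n * n * real_dim) :=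
  mxvec (\matrix_(i, j) (real_coords (mxvec P 0 i))`_j).

Definition grassmannian_set r : set 'rV[R]_(n * n * real_dim) :=
  realify @` [set P | exists2 U, subspace_of_dim r U & orthogonal_projection U P].

(* The sets [grassmannian_set r] are pairwise disjoint and Zariski closed, since
   the trace of the orthogonal projection onto U is the dimension of U, so their
   union is their coproduct. *)
Definition grassmannian : fspace R :=
  subfspace (S := affine_space R (n * n * real_dim))
    (\bigcup_(r in [set r | (r <= n)%N]) grassmannian_set r).

End Grassmannians.

(* Main.v *)
(** Choose finitely many closed balls [u_i <= 0] of the ambient affine space that
cover [X] and whose traces on [X] are contractible in [X]; the strata record
which of the polynomials [u_i] vanish.  On a connected component of a stratum in
[X] every [u_i] has constant sign, so [d_i = max(0, u_i)] is polynomial there.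

Let [P : X -> projections] be the map to approximate.  Over the contractible set
[X_i = X /\ {u_i <= 0}] the bundle of the ranges of [P] is trivial: there are
continuous [s_i] on [X] with [P s_i = s_i] which over [X_i] restrict to an
isomorphism from the range of a constant projection [E_i] onto that of [P].
Approximate [s_i] by polynomials [M_i] and put

    [C_j = (M_k M_k^T + d_k) ... (M_(j+1) M_(j+1)^T + d_(j+1)) M_j].

With [s] in place of [M] every factor preserves the range of [P] and is positive
definite on it ([d_i] is positive off [X_i], and [s_i s_i^T] is positive definite
on the range over [X_i]), so over [X_j] the range of [C_j] would be that of [P];
hence it is close to it.  For [j < l] the function [d_l] vanishes over [X_l], so
over [X_j /\ X_l] the range of [C_j] is contained in the range of [C_l], and
being close the two coincide.  The ranges of the [C_j] therefore glue to a
continuous map near [P], which is rational wherever the [d_i] are polynomial.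
Quaternionic and complex matrices are treated as real ones through the regular
representation. *)

Require Import Defs.
From HB Require Import structures.
From mathcomp Require Import all_boot all_order all_algebra.
From mathcomp Require Import all_classical all_reals all_analysis.
From mathcomp Require Import complex ring lra zify.
From mathcomp Require mpoly.
Import (canonicals) mpoly.

Set Implicit Arguments.
Unset Strict Implicit.
Unset Printing Implicit Defensive.

Import Order.TTheory GRing.Theory Num.Theory.
Import numFieldNormedType.Exports.

Local Open Scope classical_set_scope.
Local Open Scope ring_scope.

(** * Limits of matrix-valued functions *)

Section MatrixLimits.
Context {R : realType} {W : Type} {F : set_system W} {FF : Filter F}.

Definition mlim m n (A : W -> 'M[R]_(m, n)) (a : 'M[R]_(m, n)) :=
  forall i j, (fun w => A w i j) @ F --> a i j.

Lemma lim_sum (I : Type) (r : seq I) (P : pred I) (f : I -> W -> R) (l : I -> R) :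
  (forall i, f i @ F --> l i) ->
  (fun w => \sum_(i <- r | P i) f i w) @ F --> \sum_(i <- r | P i) l i.
Proof. by move=> fl; apply: cvg_big => //; apply: add_continuous. Qed.

Lemma lim_prod (I : Type) (r : seq I) (P : pred I) (f : I -> W -> R) (l : I -> R) :
  (forall i, f i @ F --> l i) ->
  (fun w => \prod_(i <- r | P i) f i w) @ F --> \prod_(i <- r | P i) l i.
Proof. by move=> fl; apply: cvg_big => //; apply: mul_continuous. Qed.

Lemma mlim_cst m n (a : 'M[R]_(m, n)) : mlim (fun=> a) a.
Proof. by move=> i j; apply: cvg_cst. Qed.

Lemma mlimD m n (A B : W -> 'M[R]_(m, n)) a b :
  mlim A a -> mlim B b -> mlim (fun w => A w + B w) (a + b).
Proof.
move=> Aa Bb i j; rewrite mxE (_ : (fun _ => _) = fun w => A w i j + B w i j).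
  exact: cvgD.
by apply/funext => w; rewrite mxE.
Qed.

Lemma mlimB m n (A B : W -> 'M[R]_(m, n)) a b :
  mlim A a -> mlim B b -> mlim (fun w => A w - B w) (a - b).
Proof.
move=> Aa Bb i j; rewrite !mxE (_ : (fun _ => _) = fun w => A w i j - B w i j).
  exact: cvgB.
by apply/funext => w; rewrite !mxE.
Qed.

Lemma mlimZ m n (f : W -> R) (A : W -> 'M[R]_(m, n)) (l : R) a :
  f @ F --> l -> mlim A a -> mlim (fun w => f w *: A w) (l *: a).
Proof.
move=> fl Aa i j; rewrite mxE (_ : (fun _ => _) = fun w => f w * A w i j).
  exact: cvgM.
by apply/funext => w; rewrite mxE.
Qed.

Lemma mlimM m n p (A : W -> 'M[R]_(m, n)) (B : W -> 'M[R]_(n, p)) a b :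
  mlim A a -> mlim B b -> mlim (fun w => A w *m B w) (a *m b).
Proof.
move=> Aa Bb i j.
rewrite mxE (_ : (fun _ => _) = fun w => \sum_k A w i k * B w k j).
  by apply: lim_sum => k; apply: cvgM.
by apply/funext => w; rewrite mxE.
Qed.

Lemma mlim_tr m n (A : W -> 'M[R]_(m, n)) a :
  mlim A a -> mlim (fun w => (A w)^T) a^T.
Proof.
move=> Aa i j; rewrite mxE (_ : (fun _ => _) = fun w => A w j i) //.
by apply/funext => w; rewrite mxE.
Qed.

Lemma lim_det n (A : W -> 'M[R]_n) a :
  mlim A a -> (fun w => \det (A w)) @ F --> \det a.
Proof.
move=> Aa; apply: lim_sum => s; apply: cvgM; first exact: cvg_cst.
by apply: lim_prod => i; apply: Aa.
Qed.

Lemma mlim_adj n (A : W -> 'M[R]_n) a :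
  mlim A a -> mlim (fun w => \adj (A w)) (\adj a).
Proof.
move=> Aa i j; rewrite mxE (_ : (fun _ => _) = fun w => cofactor (A w) j i).
  apply: cvgM; first exact: cvg_cst.
  apply: lim_det => i1 j1; rewrite !mxE.
  by rewrite (_ : (fun _ => _) = fun w => A w (lift j i1) (lift i j1)) //;
     apply/funext => w; rewrite !mxE.
by apply/funext => w; rewrite mxE.
Qed.

Lemma near_unitmx n (A : W -> 'M[R]_n) a :
  mlim A a -> a \in unitmx -> \forall w \near F, A w \in unitmx.
Proof.
move=> Aa; rewrite unitmxE unitfE => a0.
have := lim_det Aa => /cvgrPdist_lt /(_ `|\det a|); rewrite normr_gt0 => /(_ a0).
apply: filterS => w; rewrite unitmxE unitfE; apply: contraTneq => ->.
by rewrite subr0 ltxx.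
Qed.

Lemma mlim_inv n (A : W -> 'M[R]_n) a :
  mlim A a -> a \in unitmx -> mlim (fun w => invmx (A w)) (invmx a).
Proof.
move=> Aa au i j; have u := near_unitmx Aa au.
(* [invmx] is the adjugate over the determinant only at units, so the limit is taken along a
   function that agrees with it eventually. *)
apply: (@cvg_trans _ ((fun w => ((\det (A w))^-1 *: \adj (A w)) i j) @ F)).
  apply: near_eq_cvg; apply: filterS u => w wu.
  by rewrite /invmx wu.
rewrite /invmx au; apply: mlimZ; last exact: mlim_adj.
apply: cvgV; last exact: lim_det.
by rewrite -unitfE -unitmxE.
Qed.

End MatrixLimits.
Arguments mlim {R W} F {m n} A a.

(** * Symmetric idempotent matrices *)

Section ProjectionMatrices.
Context {R : realType} {D : nat}.
Implicit Types (A B C E G P Q Y : 'M[R]_D).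

Lemma row_normsq_eq0 n (v : 'rV[R]_n) : v *m v^T = 0 -> v = 0.
Proof.
move=> /matrixP /(_ 0 0); rewrite !mxE => v0; apply/matrixP => i j.
have v0' : \sum_k v 0 k ^+ 2 = 0.
  by rewrite -[RHS]v0; apply: eq_bigr => k _; rewrite mxE expr2.
have := psumr_eq0P (fun k _ => sqr_ge0 (v 0 k)) v0' => /(_ j isT) /eqP.
by rewrite sqrf_eq0 => /eqP; rewrite ord1 mxE.
Qed.

Lemma unitmx_inj A : (forall v : 'rV_D, v *m A = 0 -> v = 0) -> A \in unitmx.
Proof. by move=> A0; rewrite -row_free_unit; apply: inj_row_free. Qed.

Definition sym_idem P := P^T = P /\ P *m P = P.

Lemma sym_idem_compl P : sym_idem P -> sym_idem (1%:M - P).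
Proof.
move=> [Pt PP]; split; first by rewrite linearB /= trmx1 Pt.
by rewrite mulmxBl !mulmxBr !mulmx1 mul1mx PP subrr subr0.
Qed.

(** A sum of two Gram matrices: if [v] is in the kernel, the squared norms of [v *m C] and of
    [v *m (1%:M - P)] add up to zero, so both vectors vanish. The second one vanishing means that
    [v] lies in the range of [P]. *)
Lemma unitmx_psd n (C : 'M[R]_(D, n)) P : sym_idem P ->
  (forall v : 'rV_D, v *m C = 0 -> v *m P = v -> v = 0) ->
  C *m C^T + (1%:M - P) \in unitmx.
Proof.
move=> /sym_idem_compl [Pt PP] inj; apply: unitmx_inj => v.
rewrite mulmxDr => /(congr1 (fun w => w *m v^T)).
rewrite mul0mx mulmxDl.
have -> : v *m (C *m C^T) *m v^T = (v *m C) *m (v *m C)^T.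
  by rewrite trmx_mul !mulmxA.
have -> : v *m (1%:M - P) *m v^T = (v *m (1%:M - P)) *m (v *m (1%:M - P))^T.
  by rewrite trmx_mul Pt mulmxA -[in RHS](mulmxA v) PP.
set a := v *m C; set b := v *m (1%:M - P) => ab0.
have ge0 n' (w : 'rV[R]_n') : 0 <= (w *m w^T) 0 0.
  by rewrite mxE sumr_ge0 // => i _; rewrite mxE -expr2 sqr_ge0.
have ab : (a *m a^T) 0 0 + (b *m b^T) 0 0 = 0.
  by have /matrixP /(_ 0 0) := ab0; rewrite !mxE.
have /eqP := ab; rewrite paddr_eq0 ?ge0 // => /andP[/eqP a0 /eqP b0].
have w0 n' (w : 'rV[R]_n') : (w *m w^T) 0 0 = 0 -> w = 0.
  by move=> w0; apply: row_normsq_eq0; apply/matrixP => i j; rewrite !ord1 w0 mxE.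
apply: inj; first exact: w0.
move: (w0 _ _ b0); rewrite /b mulmxBr mulmx1 => /eqP; rewrite subr_eq0.
by move=> /eqP.
Qed.

(* If [C = C E], the range of [C] is the isomorphic image of that of [E], and
   [range_proj C E] is the orthogonal projection onto it; adding [1 - E] makes the
   Gram matrix invertible. *)
Definition gram C E := C^T *m C + (1%:M - E).
Definition range_proj C E := C *m invmx (gram C E) *m C^T.

Lemma range_projP C E : sym_idem E -> C *m E = C -> gram C E \in unitmx ->
  sym_idem (range_proj C E) /\ range_proj C E *m C = C.
Proof.
move=> [Et EE] CE Wu.
have EC : E *m C^T = C^T by rewrite -{2}CE trmx_mul Et.
have WE : gram C E *m E = C^T *m C.
  by rewrite mulmxDl -mulmxA CE mulmxBl EE mul1mx subrr addr0.
have QC : range_proj C E *m C = C.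
  by rewrite -mulmxA -WE -mulmxA mulKmx.
split=> //; split; last by rewrite {2}/range_proj !mulmxA QC.
rewrite /range_proj !trmx_mul trmxK trmx_inv mulmxA; congr (_ *m invmx _ *m _).
by rewrite linearD linearB /= trmx_mul trmxK trmx1 Et.
Qed.

(** The hypothesis says that [P] is [E] conjugated by [G], so [G *m E] and [P] have the same range.
    Two symmetric idempotents that fix each other's ranges are equal, by transposing. *)
Lemma range_proj_conj P E G : sym_idem P -> sym_idem E -> G \in unitmx ->
  P *m G = G *m E -> gram (G *m E) E \in unitmx /\ range_proj (G *m E) E = P.
Proof.
move=> [Pt PP] Ep Gu PG; have [Et EE] := Ep.
have CE : G *m E *m E = G *m E by rewrite -mulmxA EE.
have Wu : gram (G *m E) E \in unitmx.
  rewrite /gram -{2}[G *m E]trmxK; apply: unitmx_psd => // v vC vE.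
  have : (G *m v^T) = 0.
    by apply: trmx_inj; rewrite trmx_mul trmxK trmx0 -[in LHS]vE -mulmxA -{1}Et
      -trmx_mul.
  move=> /(congr1 (mulmx (invmx G))); rewrite mulKmx // mulmx0.
  by move/(congr1 trmx); rewrite trmxK trmx0.
split=> //; have [[Qt QQ] QC] := range_projP Ep CE Wu.
set Q := range_proj _ _ in Qt QQ QC *.
have PQ : P *m Q = Q.
  by rewrite /Q /range_proj !mulmxA PG -[_ *m E *m E]mulmxA EE.
have QP : Q *m P = P.
  by rewrite -[P](mulmxK Gu) mulmxA PG QC.
by rewrite -PQ -Pt -[Q]Qt -trmx_mul QP.
Qed.

Definition mx_close (e : R) A B := forall i j, `|A i j - B i j| < e.

(** A kernel vector satisfies [v = v *m (1%:M - A)], so its l1 norm is at most [D / (D + 1)] times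
    itself. *)
Lemma unitmx_near1 : exists2 e : R, 0 < e &
  forall A, mx_close e A 1%:M -> A \in unitmx.
Proof.
exists (D.+1%:R^-1); first by rewrite invr_gt0 ltr0n.
move=> A A1; apply: unitmx_inj => v vA.
pose S := \sum_j `|v 0 j|.
have S0 : 0 <= S by apply: sumr_ge0.
have leS : S <= D%:R / D.+1%:R * S.
  have {1}-> : S = \sum_j `|\sum_i v 0 i * (1%:M - A) i j|.
    apply: eq_bigr => j _; congr `|_|.
    have : v *m (1%:M - A) = v by rewrite mulmxBr mulmx1 vA subr0.
    by move/matrixP => /(_ 0 j); rewrite mxE => <-.
  rewrite (@le_trans _ _ (\sum_(j < D) \sum_i `|v 0 i| * D.+1%:R^-1)) //.
    apply: ler_sum => j _; apply: (le_trans (ler_norm_sum _ _ _)).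
    apply: ler_sum => i _; rewrite normrM ler_wpM2l //.
    by move: (A1 i j); rewrite !mxE distrC => /ltW.
  by rewrite sumr_const card_ord -mulr_suml -/S -[leLHS]mulr_natl mulrA mulrAC.
have S00 : S = 0.
  apply/eqP; rewrite eq_le S0 andbT; move: leS.
  have DD : D%:R / D.+1%:R = 1 - D.+1%:R^-1 :> R.
    apply/eqP; rewrite eq_sym subr_eq -[X in _ + X]mul1r -mulrDl natr1.
    by rewrite mulfV // pnatr_eq0.
  by rewrite DD mulrBl mul1r lerBrDr gerDl pmulr_rle0 // invr_gt0 ltr0n.
apply/matrixP => i j; rewrite ord1 mxE.
have := psumr_eq0P (fun k _ => normr_ge0 (v 0 k)) S00 => /(_ j isT) /eqP.
by rewrite normr_eq0 => /eqP.
Qed.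

(** Each diagonal entry is the sum of the squares of its row; hence it is at most 1 and dominates
    the square of every entry in that row. *)
Lemma sym_idem_entry P i j : sym_idem P -> `|P i j| <= 1.
Proof.
move=> [Pt PP].
have PE a : P a a = \sum_b P a b ^+ 2.
  rewrite -{1}PP mxE; apply: eq_bigr => b _.
  by rewrite expr2 -{2}Pt mxE.
have le a b : P a b ^+ 2 <= P a a.
  by rewrite PE (bigD1 b) //= lerDl sumr_ge0 // => c _; apply: sqr_ge0.
have P1 a : P a a <= 1.
  by have := le a a; rewrite leNgt => h; rewrite leNgt; apply: contra h; nra.
by rewrite -(@expr_le1 _ 2) // -normrX ger0_norm ?sqr_ge0 // (le_trans (le i j)).
Qed.

(* Invertible when [P] and [Q] are close, and then it conjugates [Q] to [P]. *)
Definition intertwiner P Q := P *m Q + (1%:M - P) *m (1%:M - Q).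

Lemma intertwinerP P Q : sym_idem P -> sym_idem Q ->
  P *m intertwiner P Q = intertwiner P Q *m Q.
Proof.
move=> [_ PP] [_ QQ]; transitivity (P *m Q).
  rewrite /intertwiner mulmxDr !mulmxA PP [P *m (1%:M - P)]mulmxBr mulmx1 PP subrr.
  by rewrite mul0mx addr0.
rewrite /intertwiner mulmxDl -!mulmxA QQ [(1%:M - Q) *m Q]mulmxBl mul1mx QQ subrr.
by rewrite mulmx0 addr0.
Qed.

(** The intertwiner differs from 1 by [P *m (Q - P) + (P - Q) *m Q], a matrix with small entries
    because those of [P] and [Q] are bounded by 1. The threshold depends on [D] alone, which allows
    uniform subdivisions later. *)
Lemma intertwiner_unit : exists2 e : R, 0 < e &
  forall P Q, sym_idem P -> sym_idem Q -> mx_close e P Q ->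
    intertwiner P Q \in unitmx.
Proof.
have [e e0 eu] := unitmx_near1.
(* Two products of [D] terms each cost [2 * D] times the bound; the extra 1 makes the inequality
   strict and covers [D = 0]. *)
exists (e / (D.*2).+1%:R); first by rewrite divr_gt0 // ltr0n.
move=> P Q Pp Qp PQ; apply: eu => i j.
have -> : intertwiner P Q i j - (1%:M : 'M[R]_D) i j =
   (P *m (Q - P)) i j + ((P - Q) *m Q) i j.
  transitivity ((intertwiner P Q - 1%:M) i j); first by rewrite !mxE.
  transitivity ((P *m (Q - P) + (P - Q) *m Q) i j); last by rewrite mxE.
  rewrite /intertwiner !mulmxBr !mulmxBl !mulmx1 !mul1mx Pp.2 Qp.2.
  by move: (P *m Q) => PQm; rewrite !mxE; ring.
set f := e / _ in PQ *.
have f0 : 0 < f by rewrite divr_gt0 // ltr0n.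
have le1 : `|(P *m (Q - P)) i j| <= D%:R * f.
  rewrite mxE (le_trans (ler_norm_sum _ _ _)) //.
  rewrite (@le_trans _ _ (\sum_(k < D) f)) //; last first.
    by rewrite sumr_const card_ord -[leLHS]mulr_natl.
  apply: ler_sum => k _; rewrite normrM -[f]mul1r ler_pM //.
    exact: sym_idem_entry.
  by rewrite !mxE distrC ltW.
have le2 : `|((P - Q) *m Q) i j| <= D%:R * f.
  rewrite mxE (le_trans (ler_norm_sum _ _ _)) //.
  rewrite (@le_trans _ _ (\sum_(k < D) f)) //; last first.
    by rewrite sumr_const card_ord -[leLHS]mulr_natl.
  apply: ler_sum => k _; rewrite normrM -[f]mulr1 ler_pM //.
    by rewrite !mxE ltW.
  exact: sym_idem_entry.
rewrite (le_lt_trans (ler_normD _ _)) // (le_lt_trans (lerD le1 le2)) //.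
rewrite -mulrDl -natrD addnn.
have <- : (D.*2).+1%:R * f = e by rewrite /f mulrC divfK // pnatr_eq0.
by rewrite ltr_pM2r // ltr_nat.
Qed.

(** When the ranges are nested, [Q - P] is idempotent, so it is annihilated by [1%:M - (Q - P)];
    closeness makes the latter invertible. *)
Lemma sym_idem_sub_eq : exists2 e : R, 0 < e &
  forall P Q, sym_idem P -> sym_idem Q -> Q *m P = P -> mx_close e P Q -> P = Q.
Proof.
have [e e0 eu] := unitmx_near1.
exists e => // P Q [Pt PP] [Qt QQ] QP PQ.
have QP' : P *m Q = P by have := congr1 trmx QP; rewrite trmx_mul Pt Qt.
have u : 1%:M - (Q - P) \in unitmx.
  apply: eu => i j; rewrite !mxE addrAC subrr add0r opprB.
  exact: PQ.
have : (Q - P) *m (1%:M - (Q - P)) = 0.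
  have ee : (Q - P) *m (Q - P) = Q - P.
    by rewrite mulmxBr !mulmxBl QQ QP QP' PP subrr subr0.
  by rewrite mulmxBr mulmx1 ee subrr.
move/(congr1 (fun A => A *m invmx (1%:M - (Q - P)))).
by rewrite mulmxK // mul0mx => /eqP; rewrite subr_eq0 => /eqP.
Qed.

End ProjectionMatrices.

(** * The Stone-Weierstrass theorem *)

Lemma compact_finite_cover (T : topologicalType) (K : set T) (U : T -> set T) :
  compact K -> (forall x, K x -> nbhs x (U x)) ->
  exists s : seq T, (forall x, x \in s -> K x) /\
    forall x, K x -> exists2 c, c \in s & U c x.
Proof.
move=> /compact_near_coveringP cK KU.
(* The finite subsets of [K], ordered by inclusion, serve as the index filter. *)
pose F := filter_from (fun s : seq T => forall x, x \in s -> K x)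
  (fun s => [set s' : seq T | {subset s <= s'}]).
have FF : Filter F.
  apply: filter_from_filter; first by exists [::].
  move=> s t sK tK; exists (s ++ t) => [x|u uP].
    by rewrite mem_cat => /orP[/sK|/tK].
  by split=> x xs; apply: uP; rewrite mem_cat xs ?orbT.
have [x Kx|s sK /(_ s)] := cK _ F (fun s x => exists2 c, c \in s & U c x) FF.
  exists (U x, [set s' : seq T | {subset [:: x] <= s'}]); last first.
    by move=> [y s'] [Uy s'P]; exists x => //; apply: s'P; rewrite inE.
  split; first exact: KU.
  by exists [:: x] => // y; rewrite inE => /eqP ->.
by move=> /(_ (fun _ => id)) h; exists s.
Qed.

Section StoneWeierstrass.
Context {R : realType} {T : topologicalType}.
Variable A : set (T -> R).
Hypothesis cptT : compact [set: T].
Hypothesis A_continuous : forall a, A a -> continuous a.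
Hypothesis A_cst : forall c, A (fun=> c).
Hypothesis A_add : forall a b, A a -> A b -> A (fun x => a x + b x).
Hypothesis A_mul : forall a b, A a -> A b -> A (fun x => a x * b x).
Hypothesis A_sep : forall x y, x != y -> exists2 a, A a & a x != a y.

(** Membership in the uniform closure of [A], which unlike [A] is stable under absolute values and
    maxima. *)
Definition approximable (f : T -> R) :=
  forall e, 0 < e -> exists2 a, A a & forall x, `|f x - a x| < e.

Let appr_mem a : A a -> approximable a.
Proof. by move=> Aa e e0; exists a => // x; rewrite subrr normr0. Qed.

Let apprD f g : approximable f -> approximable g ->
  approximable (fun x => f x + g x).
Proof.
move=> Af Ag e e0; have e20 : 0 < e / 2 by lra.
have [a Aa af] := Af _ e20; have [b Ab bg] := Ag _ e20.
exists (fun x => a x + b x); first exact: A_add.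
move=> x; rewrite opprD addrACA (le_lt_trans (ler_normD _ _)) //.
by have := af x; have := bg x; lra.
Qed.

Let apprZ c f : approximable f -> approximable (fun x => c * f x).
Proof.
move=> Af e e0; have c0 : 0 < `|c| + 1 by rewrite ltr_wpDl.
have [|a Aa af] := Af (e / (`|c| + 1)); first by rewrite divr_gt0.
exists (fun x => c * a x); first exact: A_mul.
move=> x; rewrite -mulrBr normrM; move: (af x); rewrite ltr_pdivlMr //.
by apply: le_lt_trans; rewrite mulrC ler_wpM2l // lerDl.
Qed.

(* Polynomials in [t] increasing to [`|t|] on [-1, 1]. *)
Fixpoint abs_approx (t : R) k :=
  if k is k'.+1 then abs_approx t k' + (t ^+ 2 - abs_approx t k' ^+ 2) / 2 else 0.

Lemma abs_approxP t k : `|t| <= 1 ->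
  [/\ 0 <= abs_approx t k, abs_approx t k <= `|t| &
      (`|t| - abs_approx t k) * k.+1%:R <= 2].
Proof.
move=> t1; elim: k => [|k [q0 qt IH]] /=.
  by split => //; rewrite subr0 mulr1; lra.
have tt : t ^+ 2 = `|t| ^+ 2 by rewrite -normrX ger0_norm // sqr_ge0.
rewrite tt; set q := abs_approx t k in q0 qt IH *; set u := `|t| in t1 qt IH *.
split; [nra|nra|].
have -> : k.+2%:R = k.+1%:R + 1 :> R by rewrite natr1.
set c := k.+1%:R in IH *.
have c0 : 1 <= c by rewrite ler1n.
have -> : (u - (q + (u ^+ 2 - q ^+ 2) / 2)) = (u - q) * (1 - (u + q) / 2).
  by field.
(* Since [q] is nonnegative, the error [e] passes to at most [e * (1 - e / 2)], a recursion whose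
   solutions decay like [2 / k]. *)
have E : (u - q) * (1 - (u + q) / 2) <= (u - q) * (1 - (u - q) / 2).
  by rewrite ler_wpM2l; lra.
rewrite (@le_trans _ _ ((u - q) * (1 - (u - q) / 2) * (c + 1))) //.
  by apply: ler_wpM2r => //; rewrite addr_ge0 // ler0n.
set e := u - q in IH *.
have e0 : 0 <= e by rewrite /e; lra.
have e1 : e <= 1 by rewrite /e; lra.
have -> : e * (1 - e / 2) * (c + 1) =
  2 - ((2 - e) * (1 - e * c / 2) + e ^+ 2 / 2) by field.
have : 0 <= (2 - e) * (1 - e * c / 2) by apply: mulr_ge0; lra.
have : 0 <= e ^+ 2 by apply: sqr_ge0.
lra.
Qed.

Let continuous_bounded (f : T -> R) : continuous f ->
  exists2 M, 0 < M & forall x, `|f x| <= M.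
Proof.
move=> cf; have : \forall M \near +oo, [set: T] `<=` [set x | `|f x| <= M].
  have /compact_near_coveringP := cptT; apply => x _.
  have /cvgrPdist_lt /(_ 1 ltr01) nf := cf x.
  near=> x' M => /=.
  have : `|f x - f x'| < 1 by near: x'.
  have : `|f x| + 1 <= M by near: M; apply: nbhs_pinfty_ge; rewrite num_real.
  have := ler_distD (f x) (f x') 0; rewrite !subr0 [`|f x' - _|]distrC; lra.
move=> MP; have : \forall M \near +oo%R, 0 < M /\ [set: T] `<=` [set x | `|f x| <= M].
  by near=> M; split; near: M => //; apply: nbhs_pinfty_gt; rewrite num_real.
by case/(@filter_ex _ _ _) => M [M0 fM]; exists M => // x; apply: fM.
Unshelve. all: end_near. Qed.

Let abs_mem a : A a -> approximable (fun x => `|a x|).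
Proof.
move=> Aa e e0; have [M M0 aM] := continuous_bounded (A_continuous Aa).
(* After rescaling [a] by [M] into [-1, 1], step [k] leaves an error of at most [2 * M / (k + 1)],
   which is below [e]. *)
pose k := Num.truncn (2 * M / e).
have Aq n : A (fun x => M * abs_approx (M^-1 * a x) n).
  apply: A_mul; first exact: A_cst.
  have At : A (fun x => M^-1 * a x) by apply: A_mul => //; exact: A_cst.
  elim: n => [|n IH] /=; first exact: A_cst.
  apply: (A_add IH); have N : A (fun x => - abs_approx (M^-1 * a x) n ^+ 2).
    under eq_fun do rewrite -mulN1r expr2.
    by apply: A_mul; [exact: A_cst | exact: A_mul].
  apply: A_mul; last exact: A_cst.
  by apply: A_add => //; under eq_fun do rewrite expr2; exact: A_mul.
exists (fun x => M * abs_approx (M^-1 * a x) k) => // x.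
set t := M^-1 * a x.
have t1 : `|t| <= 1.
  by rewrite normrM normfV (gtr0_norm M0) ler_pdivrMl // mulr1.
have -> : `|a x| = M * `|t|.
  by rewrite normrM normfV (gtr0_norm M0) mulVKf // gt_eqF.
have [q0 qt kq] := abs_approxP k t1.
rewrite -mulrBr normrM (gtr0_norm M0) ger0_norm ?subr_ge0 //.
have kM : 2 * M / e < k.+1%:R by rewrite /k truncnS_gt.
rewrite -(@ltr_pM2r _ k.+1%:R) ?ltr0n // -mulrA.
rewrite (@le_lt_trans _ _ (M * 2)) ?ler_pM2l //.
by move: kM; rewrite ltr_pdivrMr // mulrC [k.+1%:R * e]mulrC.
Qed.

Let appr_abs f : approximable f -> approximable (fun x => `|f x|).
Proof.
move=> Af e e0; have e20 : 0 < e / 2 by lra.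
have [a Aa fa] := Af _ e20; have [b Ab ab] := abs_mem Aa e20.
exists b => // x; have := ler_distD `|a x| `|f x| (b x).
have := fa x; have := ab x; have := ler_dist_dist (f x) (a x); lra.
Qed.

Let appr_max f g : approximable f -> approximable g ->
  approximable (fun x => Num.max (f x) (g x)).
Proof.
move=> Af Ag.
rewrite (_ : (fun _ => _) =
    (fun x => 2^-1 * ((f x + g x) + `|f x + (-1) * g x|))); last first.
  by apply/funext => x; rewrite mulN1r maxr_absE mulrC.
by apply/apprZ/apprD; [exact: apprD | apply/appr_abs/apprD/apprZ].
Qed.

Let appr_seq_max (G : T -> T -> R) c0 (s : seq T) :
  (forall c, approximable (G c)) ->
  exists2 h, approximable h &
    forall x, (forall c, c \in c0 :: s -> G c x <= h x) /\
              (exists2 c, c \in c0 :: s & h x = G c x).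
Proof.
move=> AG; elim: s => [|c s [h Ah hP]].
  exists (G c0) => // x; split; last by exists c0; rewrite ?inE.
  by move=> c; rewrite inE => /eqP ->.
exists (fun x => Num.max (G c x) (h x)); first exact: appr_max.
move=> x; have [h1 [c1 c1s h2]] := hP x; split.
  move=> c2; rewrite !inE le_max => /or3P[/eqP->|/eqP->|c2s].
  - by rewrite h1 ?orbT // inE eqxx.
  - by rewrite lexx.
  - by rewrite h1 ?orbT // inE c2s orbT.
case: (leP (G c x) (h x)) => _.
  by exists c1 => //; move: c1s; rewrite !inE => /orP[->|->]; rewrite ?orbT.
by exists c => //; rewrite !inE eqxx orbT.
Qed.

Let appr_continuous f : approximable f -> continuous f.
Proof.
move=> Af x; apply/cvgrPdist_lt => e e0; have e40 : 0 < e / 4 by lra.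
have [a Aa fa] := Af _ e40.
have /cvgrPdist_lt /(_ _ e40) := A_continuous Aa (x := x).
apply: filterS => y axy.
have := ler_distD (a x) (f x) (f y); have := ler_distD (a y) (a x) (f y).
by have := fa x; have := fa y; rewrite [`|f y - _|]distrC; lra.
Qed.

Theorem stone_weierstrass f : continuous f -> approximable f.
Proof.
move=> cf e e0; have e20 : 0 < e / 2 by lra.
(* A point is needed to start the list whose maximum is taken in the second stage. *)
have [[x0 _]|T0] := pselect (exists x : T, True); last first.
  by exists (fun=> 0) => // x; case: T0; exists x.
have interp x y : exists2 a, A a & a x = f x /\ a y = f y.
  have [->|xy] := eqVneq x y; first by exists (fun=> f y).
  have [a Aa axy] := A_sep xy; have d0 : a x - a y != 0 by rewrite subr_eq0.
  exists (fun z => f x + (a z + - a x) * ((f x - f y) / (a x - a y))).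
    apply: A_add => //; apply: A_mul => //; exact: A_add.
  by split; [rewrite addrN mul0r addr0 | field].
(* First stage: interpolants of [f] at [x] and [y] exceed [f - d] near [y]. The maximum of finitely
   many of them does so everywhere and still takes the value [f x] at [x]. *)
have upper d : 0 < d -> forall x, exists2 g, approximable g &
    g x = f x /\ forall y, f y - g y < d.
  move=> d0 x.
  have /choice [G GP] : forall y, exists a, A a /\ (a x = f x /\ a y = f y).
    by move=> y; have [a] := interp x y; exists a.
  have [|s [_ sP]] := compact_finite_cover
    (U := fun y => [set z | f z - G y z < d]) cptT.
    move=> y _; have [AG [_ Gy]] := GP y.
    have : (fun z => f z - G y z) @ y --> f y - G y y.
      by apply: cvgB; [exact: cf | exact: A_continuous].
    by rewrite Gy subrr => /cvgr_lt; apply.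
  have [h Ah hP] := appr_seq_max x s (fun c => appr_mem (GP c).1).
  exists h => //; split.
    by have [_ [c _ ->]] := hP x; have [_ []] := GP c.
  move=> y; have [c cs Uc] := sP y I.
  have [/(_ c) + _] := hP y; rewrite inE cs orbT => /(_ isT).
  by move: Uc => /=; lra.
have /choice [G GP] : forall x, exists g, approximable g /\
    (g x = f x /\ forall y, f y - g y < e / 2).
  by move=> x; have [g] := upper (e / 2) e20 x; exists g.
have [|s [_ sP]] := compact_finite_cover
  (U := fun x => [set z | G x z - f z < e / 2]) cptT.
  move=> x _; have [AG [Gx _]] := GP x.
  have : (fun z => G x z - f z) @ x --> G x x - f x.
    by apply: cvgB; [exact: appr_continuous | exact: cf].
  by rewrite Gx subrr => /cvgr_lt; apply.
(* Second stage: a finite minimum of such functions, written as the negative of a maximum; so [- h]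
   is the approximant. *)
have [h Ah hP] := appr_seq_max x0 s (fun c => apprZ (-1) (GP c).1).
have fh x : `|f x + h x| < e / 2.
  have [c cs Uc] := sP x I.
  have [/(_ c) + [c1 _ hc1]] := hP x; rewrite inE cs orbT => /(_ isT) hc.
  have [_ [_ /(_ x)]] := GP c1; move: Uc => /=.
  by rewrite ltr_norml => h1 h2; apply/andP; split; lra.
have [a Aa ha] := apprZ (-1) Ah e20; exists a => // x.
have := ler_distD (- h x) (f x) (a x); have := fh x; have := ha x.
by rewrite mulN1r opprK; lra.
Qed.

End StoneWeierstrass.

(** * Glued frames *)

Section Frames.
Context {R : realType} {D : nat}.
Implicit Types (A P Y : 'M[R]_D) (E L M s : nat -> 'M[R]_D) (d : nat -> R).

Fixpoint mxprod_down L j n : 'M[R]_D :=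
  if n is n'.+1 then L (j + n')%N *m mxprod_down L j n' else 1%:M.

Lemma mxprod_down_cat L j a b :
  mxprod_down L j (a + b) = mxprod_down L (j + a) b *m mxprod_down L j a.
Proof.
elim: b => [|b IH] /=; first by rewrite addn0 mul1mx.
by rewrite addnS /= IH mulmxA addnA.
Qed.

Definition spread M d i := M i *m (M i)^T + (d i)%:M.
Definition frame k M d j := mxprod_down (spread M d) j.+1 (k - j.+1) *m M j.

(* Since [d l = 0], the factor of index [l] is [M l *m (M l)^T]. *)
Lemma frame_factor k M d j l : (j < l)%N -> (l < k)%N -> d l = 0 ->
  exists A, frame k M d j = frame k M d l *m A.
Proof.
move=> jl lk dl.
exists ((M l)^T *m mxprod_down (spread M d) j.+1 (l - j.+1) *m M j).
have -> : frame k M d j =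
    mxprod_down (spread M d) j.+1 (l - j.+1 + (1 + (k - l.+1))) *m M j.
  by congr (mxprod_down _ _ _ *m _); lia.
rewrite !mxprod_down_cat /= addn0 subnKC // addn1 mulmx1 {2}/spread dl.
by rewrite raddf0 addr0 /frame !mulmxA.
Qed.

(** For the exact sections the frame equals [G *m E j] with [G] invertible and conjugating [E j] to
    [P], so [range_proj_conj] applies. *)
Lemma frame_exact k P s d E j : sym_idem P ->
  (forall i, sym_idem (E i)) -> (forall i, P *m s i = s i) ->
  (forall i, 0 <= d i) ->
  (forall i, d i = 0 -> (i < k)%N -> exists Y,
     [/\ Y \in unitmx, P *m Y = Y *m E i & s i = Y *m E i]) ->
  (j < k)%N -> d j = 0 ->
  gram (frame k s d j) (E j) \in unitmx /\ range_proj (frame k s d j) (E j) = P.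
Proof.
move=> Pp Ep Ps d0 Ys jk dj; have [Pt PP] := Pp.
have [Y [Yu PY sj]] := Ys j dj jk.
(* Adding [1%:M - P] leaves the action of [spread s d i] on the range of [P] unchanged and makes the
   factor invertible on the whole space; [L i] also commutes with [P]. *)
pose L i := spread s d i + (1%:M - P).
have sP i : (s i)^T *m P = (s i)^T by rewrite -[in RHS]Ps trmx_mul Pt.
have PL i : P *m L i = L i *m P.
  rewrite /L /spread !mulmxDr !mulmxDl mulmxA Ps -(mulmxA (s i)) sP.
  by rewrite mulmx1 mul1mx mul_mx_scalar mul_scalar_mx mulmxN mulNmx.
have LP i : spread s d i *m P = L i *m P.
  by rewrite /L [RHS]mulmxDl mulmxBl mul1mx PP subrr addr0.
have Lu i : (i < k)%N -> L i \in unitmx.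
  move=> ik; have [di|di] := eqVneq (d i) 0.
    have [Z [Zu PZ sZ]] := Ys i di ik.
    rewrite /L /spread di raddf0 addr0; apply: unitmx_psd => // v vs vP.
    have vZ : v *m Z = 0 by rewrite -vP -mulmxA PZ -sZ vs.
    by rewrite -[v](mulmxK Zu) vZ mul0mx.
  have di0 : 0 < d i by rewrite lt_def di d0.
  (* A positive [d i] is absorbed into the Gram matrix of the wider matrix [row_mx (s i) c%:M],
     whose second block already gives injectivity. *)
  have [c cd] : exists c, c ^+ 2 = d i by exists (Num.sqrt (d i)); rewrite sqr_sqrtr.
  have c0 : c != 0 by apply: contraNneq di => c0; rewrite -cd c0 expr0n.
  have -> : L i = row_mx (s i) c%:M *m (row_mx (s i) c%:M)^T + (1%:M - P).
    by rewrite tr_row_mx mul_row_col tr_scalar_mx -scalar_mxM -expr2 cd.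
  apply: unitmx_psd => // v.
  rewrite mul_mx_row -row_mx0 => /eq_row_mx [_] + _.
  by rewrite mul_mx_scalar => /eqP; rewrite scaler_eq0 (negPf c0) => /eqP.
have PG n : P *m mxprod_down L j.+1 n = mxprod_down L j.+1 n *m P.
  by elim: n => [|n IH] /=; rewrite ?mulmx1 ?mul1mx // mulmxA PL -!mulmxA IH.
have GP n : mxprod_down (spread s d) j.+1 n *m P = mxprod_down L j.+1 n *m P.
  elim: n => [|n IH] //=; rewrite -!mulmxA IH -[in LHS]PG mulmxA LP.
  by rewrite -!mulmxA PG.
have Gu : mxprod_down L j.+1 (k - j.+1) \in unitmx.
  have : (j.+1 + (k - j.+1) <= k)%N by rewrite subnKC.
  elim: (k - j.+1)%N => [|n IH] /= h; first exact: unitmx1.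
  by rewrite unitmx_mul Lu ?IH //; lia.
have -> : frame k s d j = (mxprod_down L j.+1 (k - j.+1) *m Y) *m E j.
  by rewrite /frame -Ps mulmxA GP -mulmxA Ps sj mulmxA.
apply: range_proj_conj => //; first by rewrite unitmx_mul Gu.
by rewrite mulmxA PG -mulmxA PY mulmxA.
Qed.

End Frames.

(** * Trivialization over contractible sets *)

Section Transport.
Context {R : realType} {D : nat}.

Lemma mlim_close (W : Type) (F : set_system W) {FF : Filter F}
    (A : W -> 'M[R]_D) a (e : R) :
  mlim F A a -> 0 < e -> \forall w \near F, mx_close e (A w) a.
Proof.
move=> Aa e0; apply: filter_forall => i; apply: filter_forall => j.
by have /cvgrPdist_lt /(_ e e0) := Aa i j; apply: filterS => w; rewrite distrC.
Qed.

Lemma mx_close_trans (e : R) (A B C : 'M[R]_D) :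
  mx_close (e / 2) A B -> mx_close (e / 2) C B -> mx_close e A C.
Proof.
move=> AB CB i j; have := ler_distD (B i j) (A i j) (C i j).
by have := AB i j; have := CB i j; rewrite [`|C i j - _|]distrC; lra.
Qed.

Variables (T : topologicalType) (P : T -> 'M[R]_D).
Hypothesis P_cont : forall x, mlim (nbhs x) P (P x).
Hypothesis P_proj : forall x, sym_idem (P x).

Variables (N : set T) (H : T * R -> T).
Hypothesis H_cont : {within N `*` [set` `[0, 1]], continuous H}.

Lemma mlim_homotopy (x : T) (t : R) : N x -> 0 <= t <= 1 ->
  mlim (within (N `*` [set` `[0, 1]]) (nbhs (x, t))) (P \o H) (P (H (x, t))).
Proof.
move=> Nx t01 i j; have cH := (subspace_continuousP _ _).1 H_cont.
apply: (cvg_comp H (fun y => P y i j)); last exact: P_cont.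
by apply: cH; split => //=; rewrite in_itv.
Qed.

Variable K : set T.
Hypotheses (K_compact : compact K) (KN : K `<=` N).

(** Uniform continuity in the time variable: compactness of [K] times [0, 1] is applied to the
    filter of steps [d] tending to 0 from above. *)
Lemma homotopy_uniform (e : R) : 0 < e -> exists2 d : R, 0 < d &
  forall (x : T) (t t' : R), K x -> 0 <= t <= 1 -> 0 <= t' <= 1 -> `|t - t'| < d ->
    mx_close e (P (H (x, t))) (P (H (x, t'))).
Proof.
move=> e0; have e20 : 0 < e / 2 by rewrite divr_gt0.
have cK : compact (K `*` [set` `[0 : R, 1]]).
  by apply: compact_setX => //; apply: segment_compact.
pose Q (d : R) (z : T * R) := forall t', 0 <= t' <= 1 -> `|z.2 - t'| < d ->
  mx_close e (P (H z)) (P (H (z.1, t'))).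
have : \forall d \near 0^'+, K `*` [set` `[0, 1]] `<=` Q d.
  move/compact_near_coveringP/near_covering_withinP : cK; apply.
  move=> [x t] [/= Kx]; rewrite in_itv /= => t01.
  have := mlim_close (mlim_homotopy (KN Kx) t01) e20.
  rewrite near_withinE => -[/= [U I] /= [Ux It] UI].
  have /nbhs_ballP [r /= r0 rI] := It.
  have r20 : 0 < r / 2 by rewrite divr_gt0.
  exists ((U `*` ball t (r / 2)), [set d | d < r / 2]).
    split => /=; last exact: nbhs_right_lt.
    by exists (U, ball t (r / 2)) => //; split => //; apply: nbhsx_ballx.
  move=> [[x' s] d] /= [[Ux' /= ts] dr] [/= Kx'].
  rewrite in_itv /= => s01 t' t'01 /= st'.
  have A01 u : 0 <= u <= 1 -> (N `*` [set` `[0, 1]]) (x', u).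
    by move=> u01; split; [exact: KN | rewrite /= in_itv].
  apply: (@mx_close_trans _ _ (P (H (x, t))));
    [apply: (UI (x', s)) | apply: (UI (x', t'))].
  - by split => //=; apply: rI; apply: le_ball ts; lra.
  - exact: A01.
  - split => //=; apply: rI; move: ts; rewrite /ball /= => ts.
    by have := ler_distD s t t'; lra.
  - exact: A01.
move=> KQ; have : \forall d \near 0^'+, 0 < d /\ K `*` [set` `[0, 1]] `<=` Q d.
  by near=> d; split; near: d => //; apply: nbhs_right_gt.
case/filter_ex => d [d0 dP]; exists d => // x t t' Kx t01 t'01 tt'.
by apply: (dP (x, t)) => //; split => //=; rewrite in_itv.
Unshelve. all: end_near. Qed.

Variable S : set 'M[R]_D.
Hypotheses (S1 : S 1%:M) (SB : forall A B, S A -> S B -> S (A - B)).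
Hypotheses (SM : forall A B, S A -> S B -> S (A *m B)) (SP : forall x, S (P x)).

(** Consecutive projections along a fine subdivision are close, so their intertwiners are invertible
    and compose to a conjugation between the two ends of the path. The set [S] is a subring
    containing the projections; it will be the ring of matrices that are linear over the scalar
    field. *)
Lemma parallel_transport : exists Y : T -> 'M[R]_D, forall x, K x ->
  [/\ Y x \in unitmx, P (H (x, 0)) *m Y x = Y x *m P (H (x, 1)), S (Y x) &
      mlim (within K (nbhs x)) Y (Y x)].
Proof.
have [e e0 eu] := @intertwiner_unit R D.
have [d d0 Hd] := homotopy_uniform e0.
pose q := (Num.truncn d^-1).+1.
have qd : q%:R^-1 < d by rewrite invf_plt ?posrE ?ltr0n // truncnS_gt.
(* The product of the intertwiners along a subdivision of the path [H (x, -)]. *)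
pose Pa x a := P (H (x, a%:R / q%:R)).
pose Y := fix Y n x := if n is n'.+1
  then Y n' x *m intertwiner (Pa x n') (Pa x n'.+1) else 1%:M : 'M[R]_D.
have t01 a : (a <= q)%N -> 0 <= (a%:R / q%:R : R) <= 1.
  by move=> aq; rewrite divr_ge0 //= ler_pdivrMr ?ltr0n // mul1r ler_nat.
have SD A B : S A -> S B -> S (A + B).
  move=> SA SB'; rewrite -[B]opprK; apply: (SB SA).
  by rewrite -[- B]add0r -{1}(subrr B); apply: (SB (SB SB' SB')).
exists (Y q) => x Kx.
have : (q <= q)%N by [].
suff : forall n, (n <= q)%N -> [/\ Y n x \in unitmx, 
    Pa x 0 *m Y n x = Y n x *m Pa x n, S (Y n x) &
    mlim (within K (nbhs x)) (Y n) (Y n x)].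
  move=> /[apply]; rewrite /Pa mul0r mulfV ?pnatr_eq0 //.
elim=> [|n IH] nq.
  split; [exact: unitmx1 | by rewrite mulmx1 mul1mx | by [] | exact: mlim_cst].
have [Yu YP YS Yc] := IH (ltnW nq).
have Pc a : (a <= q)%N -> mlim (within K (nbhs x)) (Pa ^~ a) (Pa x a).
  move=> aq i j.
  apply: (cvg_comp (fun y => (y, a%:R / q%:R)) (fun z => (P \o H) z i j)); last first.
    exact: (mlim_homotopy (KN Kx) (t01 _ aq)).
  move=> B [[U I] /= [Ux It] UI]; apply: filterS Ux => y Uy Ky.
  apply: (UI (y, _)); first by split => //; exact: nbhs_singleton.
  by split => /=; [exact: KN | rewrite in_itv /= t01].
split.
- rewrite unitmx_mul Yu; apply: eu; try exact: P_proj.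
  apply: Hd; rewrite ?t01 ?(ltnW nq) //.
  by rewrite distrC -mulrBl -natrB // subSnn mul1r normfV ger0_norm.
- by rewrite mulmxA YP -mulmxA intertwinerP ?mulmxA //; exact: P_proj.
- apply: SM => //; apply: SD; first by apply: SM; apply: SP.
  by apply: SM; apply: SB => //; apply: SP.
- apply: mlimM => //; apply: mlimD.
    by apply: mlimM; apply: Pc => //; apply: ltnW.
  by apply: mlimM; apply: mlimB; (exact: mlim_cst || apply: Pc => //; apply: ltnW).
Qed.

End Transport.

(** * Polynomial approximation of frames *)

Section LimitsOfFrames.
Context {R : realType} {W : Type} {F : set_system W} {FF : Filter F}.

Lemma lim_exp (f : W -> R) (l : R) n :
  f @ F --> l -> f w ^+ n @[w --> F] --> l ^+ n.
Proof.
move=> fl; elim: n => [|n IH]; first exact: cvg_cst.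
by under eq_cvg do rewrite exprS; rewrite exprS; apply: cvgM.
Qed.

Lemma linear_mx_entry m n p q (f : {linear 'M[R]_(m, n) -> 'M[R]_(p, q)}) B i j :
  f B i j = \sum_b \sum_c B b c * f (delta_mx b c) i j.
Proof.
rewrite {1}[B]matrix_sum_delta linear_sum summxE; apply: eq_bigr => b _.
by rewrite linear_sum summxE; apply: eq_bigr => c _; rewrite linearZ mxE.
Qed.

Lemma mlim_linear m n p q (f : {linear 'M[R]_(m, n) -> 'M[R]_(p, q)})
    (A : W -> 'M[R]_(m, n)) a : mlim F A a -> mlim F (fun w => f (A w)) (f a).
Proof.
move=> Aa i j.
rewrite linear_mx_entry.
rewrite (_ : (fun _ => _) = fun w => \sum_b \sum_c A w b c * f (delta_mx b c) i j).
  by apply: lim_sum => b; apply: lim_sum => c; apply: cvgM => //; exact: cvg_cst.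
by apply/funext => w; rewrite linear_mx_entry.
Qed.

Lemma mlim_scalar D (f : W -> R) l :
  f @ F --> l -> mlim F (fun w => (f w)%:M : 'M[R]_D) l%:M.
Proof.
move=> fl i j; rewrite mxE (_ : (fun _ => _) = fun w => f w *+ (i == j)).
  by apply: cvgMn.
by apply/funext => w; rewrite mxE.
Qed.

Context {D : nat}.

Lemma mlim_mxprod_down (L : nat -> W -> 'M[R]_D) l j n :
  (forall i, mlim F (L i) (l i)) ->
  mlim F (fun w => mxprod_down (L ^~ w) j n) (mxprod_down l j n).
Proof.
by move=> Ll; elim: n => [|n IH] /=; [exact: mlim_cst | exact: mlimM].
Qed.

Lemma mlim_frame k (M : nat -> W -> 'M[R]_D) a (d : nat -> W -> R) b j :
  (forall i, mlim F (M i) (a i)) -> (forall i, d i @ F --> b i) ->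
  mlim F (fun w => frame k (M ^~ w) (d ^~ w) j) (frame k a b j).
Proof.
move=> Ma db; apply: mlimM => //; apply: mlim_mxprod_down => i.
by apply: mlimD; [apply: mlimM => //; exact: mlim_tr | exact: mlim_scalar].
Qed.

Lemma mlim_gram (C : W -> 'M[R]_D) c E :
  mlim F C c -> mlim F (fun w => gram (C w) E) (gram c E).
Proof.
move=> Cc; apply: mlimD; last exact: mlim_cst.
by apply: mlimM => //; apply: mlim_tr.
Qed.

Lemma mlim_range_proj (C : W -> 'M[R]_D) c E :
  mlim F C c -> gram c E \in unitmx ->
  mlim F (fun w => range_proj (C w) E) (range_proj c E).
Proof.
move=> Cc u; apply: mlimM; last exact: mlim_tr.
by apply: mlimM => //; apply: mlim_inv => //; exact: mlim_gram.
Qed.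

End LimitsOfFrames.

(** * Polynomial functions and polynomial matrices *)

Section PolynomialFunctions.
Context {R : realType} {m : nat}.
Implicit Types f g : 'rV[R]_m -> R.

Definition polyfun f :=
  exists p : mpoly.mpoly m R, forall z, f z = mpoly.meval (z 0) p.

Lemma polyfun_cst c : polyfun (fun=> c).
Proof. by exists (mpoly.mpolyC m c) => z; rewrite mpoly.mevalC. Qed.

Lemma polyfun_coord i : polyfun (fun z => z 0 i).
Proof. by exists (mpoly.mpolyX R (mpoly.mnm1 i)) => z; rewrite mpoly.mevalXU. Qed.

Lemma polyfunD f g : polyfun f -> polyfun g -> polyfun (fun z => f z + g z).
Proof. by move=> [p fp] [q gq]; exists (p + q) => z; rewrite mpoly.mevalD fp gq. Qed.

Lemma polyfunM f g : polyfun f -> polyfun g -> polyfun (fun z => f z * g z).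
Proof. by move=> [p fp] [q gq]; exists (p * q) => z; rewrite mpoly.mevalM fp gq. Qed.

Lemma polyfunN f : polyfun f -> polyfun (fun z => - f z).
Proof. by move=> [p fp]; exists (- p) => z; rewrite mpoly.mevalN fp. Qed.

Lemma polyfunB f g : polyfun f -> polyfun g -> polyfun (fun z => f z - g z).
Proof. by move=> ? ?; apply: polyfunD => //; exact: polyfunN. Qed.

Lemma polyfun_sum (I : Type) (r : seq I) (P : pred I) (f : I -> 'rV[R]_m -> R) :
  (forall i, polyfun (f i)) -> polyfun (fun z => \sum_(i <- r | P i) f i z).
Proof.
move=> /choice [p fp]; exists (\sum_(i <- r | P i) p i) => z.
by rewrite raddf_sum; apply: eq_bigr => i _; apply: fp.
Qed.

Lemma polyfun_prod (I : Type) (r : seq I) (P : pred I) (f : I -> 'rV[R]_m -> R) :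
  (forall i, polyfun (f i)) -> polyfun (fun z => \prod_(i <- r | P i) f i z).
Proof.
move=> /choice [p fp]; exists (\prod_(i <- r | P i) p i) => z.
by rewrite rmorph_prod; apply: eq_bigr => i _; apply: fp.
Qed.

Lemma polyfun_lim (W : Type) (F : set_system W) {FF : Filter F} f
    (A : W -> 'rV[R]_m) a : polyfun f -> mlim F A a -> f (A w) @[w --> F] --> f a.
Proof.
move=> [p fp] Aa; rewrite fp; under eq_cvg do rewrite fp.
apply: lim_sum => c; apply: cvgM; first exact: cvg_cst.
apply: lim_prod => i; apply: lim_exp; exact: Aa.
Qed.

Definition polymx n p (A : 'rV[R]_m -> 'M[R]_(n, p)) :=
  forall i j, polyfun (fun z => A z i j).

Lemma polymx_cst n p (A : 'M[R]_(n, p)) : polymx (fun=> A).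
Proof. by move=> i j; apply: polyfun_cst. Qed.

Lemma polymxD n p (A B : 'rV[R]_m -> 'M[R]_(n, p)) :
  polymx A -> polymx B -> polymx (fun z => A z + B z).
Proof.
move=> pA pB i j; under eq_fun do rewrite mxE; exact: polyfunD.
Qed.

Lemma polymx_tr n p (A : 'rV[R]_m -> 'M[R]_(n, p)) :
  polymx A -> polymx (fun z => (A z)^T).
Proof. by move=> pA i j; under eq_fun do rewrite mxE. Qed.

Lemma polymxM n p q (A : 'rV[R]_m -> 'M[R]_(n, p)) (B : 'rV[R]_m -> 'M[R]_(p, q)) :
  polymx A -> polymx B -> polymx (fun z => A z *m B z).
Proof.
move=> pA pB i j; under eq_fun do rewrite mxE.
by apply: polyfun_sum => l; apply: polyfunM.
Qed.

Lemma polymx_scalar n f : polyfun f -> polymx (fun z => (f z)%:M : 'M[R]_n).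
Proof.
move=> pf i j; under eq_fun do rewrite mxE.
by case: (i == j) => //; apply: polyfun_cst.
Qed.

Lemma polyfun_det n (A : 'rV[R]_m -> 'M[R]_n) :
  polymx A -> polyfun (fun z => \det (A z)).
Proof.
move=> pA; apply: polyfun_sum => s; apply: polyfunM; first exact: polyfun_cst.
by apply: polyfun_prod => i; apply: pA.
Qed.

Lemma polymx_adj n (A : 'rV[R]_m -> 'M[R]_n) :
  polymx A -> polymx (fun z => \adj (A z)).
Proof.
move=> pA i j; under eq_fun do rewrite mxE.
apply: polyfunM; first exact: polyfun_cst.
by apply: polyfun_det => a b; under eq_fun do rewrite !mxE.
Qed.

Lemma polymx_linear n p q r (f : {linear 'M[R]_(n, p) -> 'M[R]_(q, r)})
  (A : 'rV[R]_m -> 'M[R]_(n, p)) : polymx A -> polymx (fun z => f (A z)).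
Proof.
move=> pA i j.
under eq_fun do rewrite linear_mx_entry.
apply: polyfun_sum => b; apply: polyfun_sum => c.
by apply: polyfunM => //; apply: polyfun_cst.
Qed.

Lemma polymx_frame D k (M : nat -> 'rV[R]_m -> 'M[R]_D) (d : nat -> 'rV[R]_m -> R) j :
  (forall i, polymx (M i)) -> (forall i, polyfun (d i)) ->
  polymx (fun z => frame k (M ^~ z) (d ^~ z) j).
Proof.
move=> pM pd; apply: polymxM => //.
elim: (k - j.+1)%N => [|n IH] /=; first exact: polymx_cst.
apply: polymxM => //; apply: polymxD; last exact: polymx_scalar.
by apply: polymxM => //; exact: polymx_tr.
Qed.

End PolynomialFunctions.

(** * Approximation on a compact space embedded by coordinates *)

Section Approximation.
Context {R : realType} {T : topologicalType} {m : nat} (xi : T -> 'rV[R]_m).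
Hypothesis T_compact : compact [set: T].
Hypothesis xi_cont : forall i, continuous (fun x => xi x 0 i).
Hypothesis xi_inj : injective xi.

Lemma polyfun_continuous f : polyfun f -> continuous (f \o xi).
Proof.
by move=> pf x; apply: polyfun_lim pf _ => i j; rewrite ord1; apply: xi_cont.
Qed.

Lemma polyfun_dense (f : T -> R) e : continuous f -> 0 < e ->
  exists2 g, polyfun g & forall x, `|f x - g (xi x)| < e.
Proof.
move=> cf e0.
have := @stone_weierstrass R T [set a | exists2 g, polyfun g & a = g \o xi] T_compact.
case/(_ _ _ _ _ _ f cf e e0).
- by move=> _ [g pg ->]; exact: polyfun_continuous.
- by move=> c; exists (fun=> c) => //; exact: polyfun_cst.
- by move=> _ _ [g pg ->] [h ph ->]; exists (fun z => g z + h z) => //; exact: polyfunD.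
- by move=> _ _ [g pg ->] [h ph ->]; exists (fun z => g z * h z) => //; exact: polyfunM.
- move=> x y xy; have : xi x != xi y by apply: contra_neq xy; exact: xi_inj.
  move=> /eqP nxy; have [i xyi] : exists i, xi x 0 i != xi y 0 i.
    apply: contrapT => /forallNP h; apply: nxy; apply/matrixP => a i.
    by rewrite ord1; apply/eqP/negPn/negP; apply: h.
  by exists ((fun z => z 0 i) \o xi) => //; exists (fun z => z 0 i) => //;
    exact: polyfun_coord.
- by move=> a [g pg ->] fg; exists g.
Qed.

Lemma xi_hausdorff : hausdorff_space T.
Proof.
move=> x y xy; apply: xi_inj; apply/matrixP => a i; rewrite ord1.
apply: (@norm_hausdorff _ R^o) => A B nA nB.
by have [z [Az Bz]] := xy _ _ (xi_cont nA) (xi_cont nB); exists (xi z 0 i).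
Qed.

Context {N D : nat} (rho : {linear 'rV[R]_N -> 'M[R]_D})
  (lam : {linear 'M[R]_D -> 'rV[R]_N}).
Hypothesis rhoK : cancel rho lam.
Hypothesis rho1 : range rho 1%:M.
Hypothesis rhoM : forall A B, range rho A -> range rho B -> range rho (A *m B).

(** Thus [rho \o lam] is a linear retraction of all real matrices onto the subring [range rho]; it
    brings extended or approximated matrices back into that subring. *)
Lemma rho_lam A : range rho A -> rho (lam A) = A.
Proof. by move=> [v _ <-]; rewrite rhoK. Qed.

Lemma rhoB A B : range rho A -> range rho B -> range rho (A - B).
Proof. by move=> [v _ <-] [w _ <-]; exists (v - w); rewrite ?linearB. Qed.

Variable P : T -> 'M[R]_D.
Hypothesis P_cont : forall x, mlim (nbhs x) P (P x).
Hypothesis P_proj : forall x, sym_idem (P x).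
Hypothesis rhoP : forall x, range rho (P x).

(** Transport along the contraction trivializes the bundle over [K]. The transport is extended entry
    by entry with Tietze's theorem, retracted to [range rho], and cut down by [P x] and [P c], which
    enforces the identities off [K] as well. *)
Lemma frame_section (K Nb : set T) (H : T * R -> T) c :
  closed K -> K `<=` Nb -> {within Nb `*` [set` `[0, 1]], continuous H} ->
  (forall x, Nb x -> H (x, 0) = x) -> (forall x, Nb x -> H (x, 1) = c) ->
  exists s : T -> 'M[R]_D,
    [/\ forall x, mlim (nbhs x) s (s x), forall x, P x *m s x = s x,
        forall x, s x *m P c = s x, forall x, range rho (s x) &
        forall x, K x -> exists Y,
          [/\ Y \in unitmx, P x *m Y = Y *m P c & s x = Y *m P c]].
Proof.
move=> clK KN cH H0 H1.
have cK : compact K by apply: (subclosed_compact clK T_compact).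
have [Y YP] := parallel_transport P_cont P_proj cH cK KN rho1 rhoB rhoM rhoP.
have [_ PP] := P_proj c.
have ext i j : exists g : T -> R, continuous g /\ forall x, K x -> g x = Y x i j.
  have cY : {within K, continuous (fun x => Y x i j : R^o)}.
    by apply/subspace_continuousP => x /YP [_ _ _]; apply.
  have : compact [set (Y x i j : R^o) | x in K] by exact: continuous_compact.
  move=> /compact_bounded [M [_ MY]].
  have [||g [Kg cg _]] := @continuous_bounded_extension T R
    (compact_normal xi_hausdorff T_compact) K clK (fun x => Y x i j) (`|M| + 1) _ cY.
  - by rewrite ltr_wpDl.
  - move=> x Kx; apply: (MY (`|M| + 1)); last by exists x.
    by rewrite (le_lt_trans (ler_norm M)) // ltrDl.
  - by exists g; split => // x Kx; rewrite -Kg // inE.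
have /choice [g gP] : forall i, exists g : 'I_D -> T -> R, forall j,
    continuous (g j) /\ forall x, K x -> g j x = Y x i j.
  by move=> i; have /choice [g gP] := ext i; exists g.
pose y x := rho (lam (\matrix_(i, j) g i j x)).
exists (fun x => P x *m y x *m P c); split.
- move=> x; apply: mlimM; last exact: mlim_cst.
  apply: mlimM => //; do 2 apply: mlim_linear.
  by move=> i j; rewrite mxE; under eq_fun do rewrite mxE; exact: (gP i j).1.
- by move=> x; rewrite !mulmxA (P_proj x).2.
- by move=> x; rewrite -mulmxA PP.
- by move=> x; apply: rhoM => //; apply: rhoM => //; eexists.
move=> x Kx; have [Yu PY rY _] := YP x Kx.
rewrite H0 ?H1 in PY; [|exact: KN..].
exists (Y x); split => //.
have -> : y x = Y x.
  rewrite -[RHS]rho_lam // /y; congr (rho (lam _)).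
  by apply/matrixP => i j; rewrite mxE (gP i j).2.
by rewrite PY -mulmxA PP.
Qed.

(** The coordinates of [s] are approximated within [1 / (p + 1)], reassembled by [rho] and
    multiplied by [E]. Convergence is stated jointly in the point and the index, so that limit
    lemmas and compactness apply to it directly. *)
Lemma section_approx (s : T -> 'M[R]_D) E : (forall x, mlim (nbhs x) s (s x)) ->
  (forall x, range rho (s x)) -> range rho E -> E *m E = E ->
  (forall x, s x *m E = s x) ->
  exists M : nat -> 'rV[R]_m -> 'M[R]_D,
    [/\ forall p, polymx (M p), forall p z, range rho (M p z),
        forall p z, M p z *m E = M p z &
        forall x, mlim (filter_prod (nbhs x) \oo)
          (fun w : T * nat => M w.2 (xi w.1)) (s x)].
Proof.
move=> cs rs rE EE sE.
have /choice [q qP] : forall p : nat, exists q : 'I_N -> 'rV[R]_m -> R, forall l,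
    polyfun (q l) /\ forall x, `|lam (s x) 0 l - q l (xi x)| < p.+1%:R^-1.
  move=> p; suff /choice [q qP] : forall l, exists q : 'rV[R]_m -> R,
    polyfun q /\ forall x, `|lam (s x) 0 l - q (xi x)| < p.+1%:R^-1 by exists q.
  move=> l; have cl : continuous (fun x => lam (s x) 0 l).
    by move=> x; apply: (mlim_linear (f := lam) (cs x)).
  by have [|g] := polyfun_dense cl (e := p.+1%:R^-1); [rewrite invr_gt0 | exists g].
exists (fun p z => rho (\row_l q p l z) *m E); split.
- move=> p; apply: polymxM; last exact: polymx_cst.
  apply: polymx_linear => i l; under eq_fun do rewrite mxE.
  exact: (qP p l).1.
- by move=> p z; apply: rhoM => //; eexists.
- by move=> p z; rewrite -mulmxA EE.
move=> x; rewrite -[s x]sE -[s x]rho_lam //.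
apply: mlimM; last exact: mlim_cst.
apply: mlim_linear => i l; rewrite ord1; under eq_fun do rewrite mxE.
have cl : (fun w : T * nat => lam (s w.1) 0 l) @ filter_prod (nbhs x) \oo -->
    lam (s x) 0 l.
  apply: (cvg_comp fst (fun y => lam (s y) 0 l)); first exact: cvg_fst.
  exact: (mlim_linear (f := lam) (cs x)).
apply/cvgrPdist_lt => e e0; have e20 : 0 < e / 2 by lra.
have /cvgrPdist_lt /(_ _ e20) n1 := cl.
have n2 : \forall w \near filter_prod (nbhs x) \oo, (w.2.+1%:R^-1 : R) < e / 2.
  exists (setT, [set p : nat | (p.+1%:R^-1 : R) < e / 2]); last by move=> [y p] [].
  split; first exact: filterT.
  have /cvgrPdist_lt /(_ _ e20) := @cvg_harmonic R.
  by apply: filterS => p; rewrite sub0r normrN ger0_norm // invr_ge0.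
near=> w.
have w1 : `|lam (s x) 0 l - lam (s w.1) 0 l| < e / 2 by near: w.
have w2 : (w.2.+1%:R^-1 : R) < e / 2 by near: w.
rewrite [e]splitr (le_lt_trans (ler_distD (lam (s w.1) 0 l) _ _)) // ltrD //.
exact: lt_trans ((qP w.2 l).2 w.1) w2.
Unshelve. all: end_near. Qed.

Variables (k : nat) (u : nat -> 'rV[R]_m -> R).
Hypothesis u_poly : forall i, polyfun (u i).
Hypothesis u_contractible : forall i, (i < k)%N ->
  exists (Nb : set T) (H : T * R -> T) (c : T),
    [/\ [set x | u i (xi x) <= 0] `<=` Nb,
        {within Nb `*` [set` `[0, 1]], continuous H},
        forall x, Nb x -> H (x, 0) = x & forall x, Nb x -> H (x, 1) = c].

Definition overshoot i z := Num.max 0 (u i z).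

Lemma overshoot_continuous i : continuous (fun x => overshoot i (xi x)).
Proof.
move=> x; apply: continuous_max; first exact: cvg_cst.
exact: (polyfun_continuous (u_poly i)).
Qed.

(** At a point and in the limit of the index, [frame_exact] identifies the projection with [P].
    Compactness then yields one index [p] good at every point, and nested ranges that are close to
    [P] must coincide. *)
Theorem frame_approximation e : 0 < e ->
  exists (E : nat -> 'M[R]_D) (M : nat -> 'rV[R]_m -> 'M[R]_D),
  let C j z := frame k (M ^~ z) (overshoot ^~ z) j in
  [/\ forall i, sym_idem (E i) /\ range rho (E i),
      forall i, polymx (M i) /\ forall z, range rho (M i z),
      forall i z, M i z *m E i = M i z,
      forall x j, (j < k)%N -> u j (xi x) <= 0 ->
        gram (C j (xi x)) (E j) \in unitmx /\
        mx_close e (range_proj (C j (xi x)) (E j)) (P x) &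
      forall x i j, (i < k)%N -> (j < k)%N -> u i (xi x) <= 0 -> u j (xi x) <= 0 ->
        range_proj (C i (xi x)) (E i) = range_proj (C j (xi x)) (E j)].
Proof.
move=> e0.
have uc i : continuous (fun x => u i (xi x)) by exact: polyfun_continuous.
have /choice [E /choice [s sP]] : forall i, exists E : 'M[R]_D, exists s : T -> 'M[R]_D,
    [/\ sym_idem E /\ range rho E, forall x, mlim (nbhs x) s (s x),
      forall x, P x *m s x = s x,
      (forall x, s x *m E = s x) /\ forall x, range rho (s x) &
      (i < k)%N -> forall x, u i (xi x) <= 0 -> exists Y,
          [/\ Y \in unitmx, P x *m Y = Y *m E & s x = Y *m E]].
  move=> i; have [ik|ki] := ltnP i k; last first.
    (* Indices from [k] on carry no contractible set and receive zero data. *)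
    exists 0, (fun=> 0); split => //.
    - split; first by split; rewrite ?trmx0 ?mul0mx.
      by exists 0; rewrite ?linear0.
    - by move=> x; apply: mlim_cst.
    - by move=> x; rewrite mulmx0.
    - by split=> x; [rewrite mul0mx | exists 0; rewrite ?linear0].
  have [Nb [H [c [KN cH H0 H1]]]] := u_contractible ik.
  have clK : closed [set x | u i (xi x) <= 0].
    by apply: (closed_comp (f := fun x => u i (xi x)) (D := [set y | y <= 0])) => //;
      exact: closed_le.
  have [s [s1 s2 s3 s4 s5]] := frame_section clK KN cH H0 H1.
  by exists (P c), s.
have /choice [M MP] : forall i, exists M : nat -> 'rV[R]_m -> 'M[R]_D,
    [/\ forall p, polymx (M p), forall p z, range rho (M p z),
        forall p z, M p z *m E i = M p z &
        forall x, mlim (filter_prod (nbhs x) \oo)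
          (fun w : T * nat => M w.2 (xi w.1)) (s i x)].
  move=> i; have [[[_ EE] rE] cs Ps [sE rs] _] := sP i.
  exact: section_approx.
have [e1 e10 eq1] := @sym_idem_sub_eq R D.
(* The bound [e] is the required precision; [e1 / 2] puts any two of the projections within the
   threshold [e1] of [sym_idem_sub_eq]. *)
pose e2 := Num.min e (e1 / 2).
have e20 : 0 < e2 by rewrite lt_min e0 divr_gt0.
pose C p j z := frame k (fun i => M i p z) (overshoot ^~ z) j.
have key : \forall p \near \oo, [set: T] `<=` [set x | forall j : 'I_k, u j (xi x) <= 0 ->
    gram (C p j (xi x)) (E j) \in unitmx /\
    mx_close e2 (range_proj (C p j (xi x)) (E j)) (P x)].
  move/compact_near_coveringP : T_compact; apply => x _.
  suff h (j : 'I_k) : \forall w \near filter_prod (nbhs x) \oo, u j (xi w.1) <= 0 ->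
      gram (C w.2 j (xi w.1)) (E j) \in unitmx /\
      mx_close e2 (range_proj (C w.2 j (xi w.1)) (E j)) (P w.1).
    have hh := filter_forall _ h.
    case: hh => -[U V] UVx UV; exists (U, V) => // -[y p] /UV.
  (* If [u j] is positive at [x], it is so nearby and the requirement for [j] is void there. *)
  have [uj|uj] := lerP (u j (xi x)) 0; last first.
    have n1 : \forall y \near x, 0 < u j (xi y) by apply: (cvgr_gt _ (uc j x)).
    exists ([set y | 0 < u j (xi y)], setT); first by split => //; exact: filterT.
    by move=> [y p] /= [+ _]; rewrite leNgt => ->.
  have dl i : (fun w : T * nat => overshoot i (xi w.1)) @ filter_prod (nbhs x) \oo
      --> overshoot i (xi x).
    apply: (cvg_comp fst (fun y => overshoot i (xi y))); first exact: cvg_fst.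
    exact: overshoot_continuous.
  have Cl : mlim (filter_prod (nbhs x) \oo) (fun w : T * nat => C w.2 j (xi w.1))
      (frame k (s ^~ x) (overshoot ^~ (xi x)) j).
    have Ml i : mlim (filter_prod (nbhs x) \oo)
        (fun w : T * nat => M i w.2 (xi w.1)) (s i x) by have [_ _ _] := MP i.
    exact: mlim_frame Ml dl.
  have dj : overshoot j (xi x) = 0 by apply/max_idPl.
  have [Gu QP] : gram (frame k (s ^~ x) (overshoot ^~ (xi x)) j) (E j) \in unitmx /\
     range_proj (frame k (s ^~ x) (overshoot ^~ (xi x)) j) (E j) = P x.
    apply: frame_exact => //.
    - by move=> i; have [[]] := sP i.
    - by move=> i; have [_ _ ->] := sP i.
    - by move=> i; rewrite le_max lexx.
    - move=> i di ik; have [_ _ _ _] := sP i; apply => //.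
      by apply/max_idPl.
  have FFp : Filter (filter_prod (nbhs x) \oo) by exact: _.
  have n1 := near_unitmx (FF := FFp) (mlim_gram (FF := FFp) Cl) Gu.
  have e220 : 0 < e2 / 2 by lra.
  have n2 := mlim_close (FF := FFp) (mlim_range_proj (FF := FFp) Cl Gu) e220.
  have n3 : \forall y \near x, mx_close (e2 / 2) (P y) (P x).
    by apply: mlim_close => //; exact: P_cont.
  have n4 : \forall w \near filter_prod (nbhs x) \oo, mx_close (e2 / 2) (P w.1) (P x).
    exists ([set y | mx_close (e2 / 2) (P y) (P x)], setT); last by move=> [y p] [].
    by split => //; exact: filterT.
  near=> w => _; split; first exact: (near n1 w).
  apply: mx_close_trans (near n2 w _) _ => //; rewrite QP; exact: (near n4 w).
case/filter_ex: key => p pP; exists E, (fun i => M i p); split.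
- by move=> i; have [] := sP i.
- by move=> i; have [] := MP i.
- by move=> i z; have [_ _ ->] := MP i.
- move=> x j jk uj; have [? cl] := pP x I (Ordinal jk) uj; split => //.
  by move=> a b; apply: lt_le_trans (cl a b) _; rewrite ge_min lexx.
have CE i z : C p i z *m E i = C p i z.
  by rewrite -mulmxA; have [_ _ -> _] := MP i.
have Ep i : sym_idem (E i) by have [[]] := sP i.
move=> x.
(* For [i < j] the overshoot of index [j] vanishes, so [frame_factor] puts the range of frame [i]
   inside that of frame [j]. *)
have lt i j : (i < j)%N -> (j < k)%N -> u i (xi x) <= 0 -> u j (xi x) <= 0 ->
    range_proj (C p i (xi x)) (E i) = range_proj (C p j (xi x)) (E j).
  move=> ij jk ui uj; have ik := ltn_trans ij jk.
  have [iu icl] := pP x I (Ordinal ik) ui; have [ju jcl] := pP x I (Ordinal jk) uj.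
  have [ip iC] := range_projP (Ep i) (CE i (xi x)) iu.
  have [jp jC] := range_projP (Ep j) (CE j (xi x)) ju.
  apply: eq1 => //.
    have [|A CA] := @frame_factor _ _ k (fun i => M i p (xi x))
      (overshoot ^~ (xi x)) i j ij jk.
      exact/max_idPl.
    have CC : range_proj (C p j (xi x)) (E j) *m C p i (xi x) = C p i (xi x).
      by rewrite [C p i (xi x)]CA mulmxA jC.
    rewrite [range_proj (C p i _) _]/range_proj.
    by rewrite 2!(mulmxA (range_proj (C p j (xi x)) (E j))) CC.
  by apply: mx_close_trans => a b; [apply: lt_le_trans (icl a b) _ |
    apply: lt_le_trans (jcl a b) _]; rewrite ge_min lexx orbT.
move=> i j ik jk ui uj; have [ij|ji|->] := ltngtP i j => //; first exact: lt.
by apply/esym/lt.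
Unshelve. all: end_near. Qed.

End Approximation.

(** * Grassmannians as varieties of real matrices *)

Section RegularRepresentation.
Context {R : realType}.

Definition scalar_row k (x : Defs.scalar R k) : 'rV[R]_(real_dim k) :=
  \row_j (real_coords x)`_j.

(** Here [tau] sends the coordinates of a scalar to the real matrix of right multiplication by it,
    acting on coordinate rows; conjugation becomes transposition. *)
Lemma regular_representation k :
  exists (tau : {linear 'rV[R]_(real_dim k) -> 'M[R]_(real_dim k)})
    (inv : 'rV[R]_(real_dim k) -> Defs.scalar R k),
  [/\ cancel inv (@scalar_row k) /\ cancel (@scalar_row k) inv,
      forall x y : Defs.scalar R k, scalar_row (x + y) = scalar_row x + scalar_row y,
      forall x y : Defs.scalar R k,
        scalar_row (x * y) = scalar_row x *m tau (scalar_row y),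
      forall x : Defs.scalar R k,
        tau (scalar_row (scalar_conj x)) = (tau (scalar_row x))^T &
      forall x : Defs.scalar R k, x != 0 -> exists y, y * x = 1].
Proof.
case: k.
- pose t (w : 'rV[R]_1) : 'M[R]_1 := w.
  have lt : linear t by [].
  pose tau : {linear 'rV[R]_1 -> 'M[R]_1} :=
    HB.pack t (GRing.isLinear.Build _ _ _ _ t lt).
  exists tau, (fun w : 'rV[R]_1 => w 0 0).
  split=> /=.
  - split=> x; last by rewrite mxE.
    by apply/matrixP => i j; rewrite mxE !ord1.
  - by move=> x y; apply/matrixP => i j; rewrite !mxE !ord1.
  - by move=> x y; apply/matrixP => i j; rewrite !mxE big_ord1 /t !mxE !ord1.
  - by move=> x; apply/matrixP => i j; rewrite !mxE !ord1.
  - by move=> x x0; exists x^-1; rewrite mulVf.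
- pose t (w : 'rV[R]_2) : 'M[R]_2 := \matrix_(i, j)
    (nth [::] [:: [:: w 0 0; w 0 1]; [:: - w 0 1; w 0 0]] i)`_j.
  have lt : linear t.
    move=> a u v; apply/matrixP => -[[|[|//]] ?] [[|[|//]] ?]; rewrite !mxE //=; ring.
  pose tau : {linear 'rV[R]_2 -> 'M[R]_2} :=
    HB.pack t (GRing.isLinear.Build _ _ _ _ t lt).
  exists tau, (fun w : 'rV[R]_2 => Complex (w 0 0) (w 0 1)).
  split=> /=.
  - split=> [w|[a b]]; last by rewrite !mxE.
    apply/matrixP => i [[|[|//]] ?]; rewrite mxE ord1 /=; congr (w _ _); exact: val_inj.
  - by move=> [a b] [c d]; apply/matrixP => i [[|[|//]] ?]; rewrite !mxE.
  - move=> [a b] [c d]; apply/matrixP => i [[|[|//]] ?];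
      rewrite !mxE !big_ord_recl big_ord0 !mxE /=; ring.
  - move=> [a b]; apply/matrixP => -[[|[|//]] ?] [[|[|//]] ?]; rewrite !mxE //=; ring.
  - by move=> x x0; exists x^-1; rewrite mulVf.
pose t (w : 'rV[R]_4) : 'M[R]_4 := \matrix_(i, j)
  (nth [::] [:: [:: w 0 0; w 0 1; w 0 2; w 0 3];
                [:: - w 0 1; w 0 0; - w 0 3; w 0 2];
                [:: - w 0 2; w 0 3; w 0 0; - w 0 1];
                [:: - w 0 3; - w 0 2; w 0 1; w 0 0]] i)`_j.
have lt : linear t.
  move=> a u v; apply/matrixP => -[[|[|[|[|//]]]] ?] [[|[|[|[|//]]]] ?];
    rewrite !mxE //=; ring.
pose tau : {linear 'rV[R]_4 -> 'M[R]_4} :=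
    HB.pack t (GRing.isLinear.Build _ _ _ _ t lt).
  exists tau,
  (fun w : 'rV[R]_4 => Quaternion (w 0 0) (w 0 1) (w 0 2) (w 0 3)).
split=> /=.
- split=> [w|[a b c d]]; last by rewrite !mxE.
  apply/matrixP => i [[|[|[|[|//]]]] ?]; rewrite mxE ord1 /=; congr (w _ _);
    exact: val_inj.
- by move=> x y; apply/matrixP => i [[|[|[|[|//]]]] ?]; rewrite !mxE.
- move=> x y; apply/matrixP => i [[|[|[|[|//]]]] ?];
    rewrite !mxE !big_ord_recl big_ord0 !mxE /=; ring.
- move=> x; apply/matrixP => -[[|[|[|[|//]]]] ?] [[|[|[|[|//]]]] ?];
    rewrite !mxE //=; ring.
move=> [a b c d] x0.
(* The inverse of a quaternion is its conjugate divided by the squared norm [q]. *)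
pose q := a ^+ 2 + b ^+ 2 + c ^+ 2 + d ^+ 2.
have q0 : q != 0.
  apply: contraNneq x0 => q0.
  have := sqr_ge0 a; have := sqr_ge0 b; have := sqr_ge0 c; have := sqr_ge0 d.
  move: q0; rewrite /q => q0 d2 c2 b2 a2.
  have z (e : R) : e ^+ 2 <= 0 -> e = 0.
    move=> e2; apply/eqP; rewrite -sqrf_eq0; apply/eqP; have := sqr_ge0 e; lra.
  have -> : a = 0 by apply: z; lra.
  have -> : b = 0 by apply: z; lra.
  have -> : c = 0 by apply: z; lra.
  have -> : d = 0 by apply: z; lra.
  exact: eqxx.
exists (Quaternion (a / q) (- b / q) (- c / q) (- d / q)).
rewrite /q in q0 *.
transitivity (@Quaternion R 1 0 0 0); last by [].
by apply: (f_equal4 (@Quaternion R)) => /=; field.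
Qed.

End RegularRepresentation.

Section LinearMaps.
Context {R : realType}.

Lemma linear_left_inverse m n p (f : {linear 'rV[R]_m -> 'M[R]_(n, p)}) :
  injective f -> exists g : {linear 'M[R]_(n, p) -> 'rV[R]_m}, cancel f g.
Proof.
move=> fI; pose A := lin1_mx (mxvec \o f).
have Af : row_free A.
  apply: inj_row_free => v; rewrite mul_rV_lin1 /= => /eqP.
  by rewrite mxvec_eq0 => /eqP f0; apply: fI; rewrite f0 linear0.
exists (mulmxr (pinvmx A) \o mxvec) => v /=.
by rewrite -[mxvec (f v)](mul_rV_lin1 (mxvec \o f)) mulmxKp.
Qed.

Lemma linear_inj_surj m (f : {linear 'rV[R]_m -> 'rV[R]_m}) w :
  (forall v, f v = 0 -> v = 0) -> exists v, f v = w.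
Proof.
move=> f0; have u : lin1_mx f \in unitmx.
  by apply: unitmx_inj => v; rewrite mul_rV_lin1; apply: f0.
by exists (w *m invmx (lin1_mx f)); rewrite -mul_rV_lin1 mulmxKV.
Qed.

Context {N D : nat} (rho : {linear 'rV[R]_N -> 'M[R]_D})
  (lam : {linear 'M[R]_D -> 'rV[R]_N}).
Hypothesis rhoK : cancel rho lam.
Hypothesis rho1 : range rho 1%:M.
Hypothesis rhoM : forall A B, range rho A -> range rho B -> range rho (A *m B).

(** Left multiplication by [A] is an injective linear endomorphism of the finite-dimensional space
    [range rho], hence surjective, and the preimage of 1 is the inverse. *)
Lemma range_invmx A : range rho A -> A \in unitmx -> range rho (invmx A).
Proof.
move=> rA uA; pose f v := lam (A *m rho v).
have lf : linear f by move=> a u v; rewrite /f linearP mulmxDr -scalemxAr linearP.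
pose F : {linear 'rV[R]_N -> 'rV[R]_N} := HB.pack f (GRing.isLinear.Build _ _ _ _ f lf).
have fE v : rho (f v) = A *m rho v.
  have [w _ wE] : range rho (A *m rho v) by apply: rhoM => //; exists v.
  by rewrite /f -wE rhoK.
have [v Fv] : exists v, F v = lam 1%:M.
  apply: linear_inj_surj => v /= fv.
  have : A *m rho v = 0 by rewrite -fE fv linear0.
  move/(congr1 (mulmx (invmx A))); rewrite mulKmx // mulmx0 => r0.
  by rewrite -[v]rhoK r0 linear0.
exists v => //; have := fE v; rewrite [f v]Fv.
have [w _ wE] := rho1; rewrite -{1}wE rhoK wE => AV.
by rewrite -[RHS]mulmx1 AV mulKmx.
Qed.

End LinearMaps.

(** * Matrices over the scalar field as real block matrices *)

Section Realification.
Context {R : realType} {k : base_field}.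
Local Notation F := (Defs.scalar R k).
Local Notation d := (real_dim k).
Local Notation rc := (@scalar_row R k).
Variables (tau : {linear 'rV[R]_d -> 'M[R]_d}) (inv : 'rV[R]_d -> F).
Hypotheses (invK : cancel inv rc) (rcK : cancel rc inv).
Hypothesis rcD : forall x y : F, rc (x + y) = rc x + rc y.
Hypothesis rcM : forall x y : F, rc (x * y) = rc x *m tau (rc y).
Hypothesis tau_conj : forall x : F, tau (rc (scalar_conj x)) = (tau (rc x))^T.
Hypothesis F_inv : forall x : F, x != 0 -> exists y, y * x = 1.

Lemma rc0 : rc 0 = 0.
Proof. by apply: (addrI (rc 0)); rewrite -rcD !addr0. Qed.

Lemma rc_sum (I : Type) (r : seq I) (P : pred I) (f : I -> F) :
  rc (\sum_(i <- r | P i) f i) = \sum_(i <- r | P i) rc (f i).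
Proof. by elim/big_rec2: _ => [|i y x _ <-]; [exact: rc0 | rewrite rcD]. Qed.

Lemma mx_eq_rc (A B : 'M[R]_d) : (forall x, rc x *m A = rc x *m B) -> A = B.
Proof. by move=> AB; apply/row_matrixP => i; rewrite !rowE -[delta_mx _ _]invK AB. Qed.

Lemma tau1 : tau (rc 1) = 1%:M.
Proof. by apply: mx_eq_rc => x; rewrite -rcM mulr1 mulmx1. Qed.

Lemma tauM x y : tau (rc (x * y)) = tau (rc x) *m tau (rc y).
Proof. by apply: mx_eq_rc => z; rewrite -rcM mulrA !rcM mulmxA. Qed.

Lemma tau_inj : injective tau.
Proof.
move=> v w vw; rewrite -[v]invK -[w]invK -[inv v]mul1r -[inv w]mul1r !rcM.
by rewrite !invK vw.
Qed.

Lemma tau_rc_inj : injective (tau \o rc).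
Proof. exact: inj_comp tau_inj (can_inj rcK). Qed.

(** This and the other laws of conjugation are pulled back from transposition along the injection
    [tau \o rc], without a case split on the field. *)
Lemma conjM (x y : F) : scalar_conj (x * y) = scalar_conj y * scalar_conj x.
Proof. by apply: tau_rc_inj; rewrite /= tauM !tau_conj tauM trmx_mul. Qed.

Lemma conjD (x y : F) : scalar_conj (x + y) = scalar_conj x + scalar_conj y.
Proof. by apply: tau_rc_inj; rewrite /= rcD linearD /= !tau_conj rcD linearD linearD. Qed.

Lemma conj0 : scalar_conj (0 : F) = 0.
Proof. by apply: tau_rc_inj; rewrite /= tau_conj rc0 linear0 trmx0. Qed.

Lemma conj_sum (I : Type) (r : seq I) (P : pred I) (f : I -> F) :
  scalar_conj (\sum_(i <- r | P i) f i) = \sum_(i <- r | P i) scalar_conj (f i).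
Proof. by elim/big_rec2: _ => [|i y x _ <-]; [exact: conj0 | rewrite conjD]. Qed.

Lemma conjK (x : F) : scalar_conj (scalar_conj x) = x.
Proof. by apply: tau_rc_inj; rewrite /= !tau_conj trmxK. Qed.

Definition adjoint p q (A : 'M[F]_(p, q)) : 'M[F]_(q, p) :=
  \matrix_(i, j) scalar_conj (A j i).

Lemma adjointM p q r (A : 'M[F]_(p, q)) (B : 'M[F]_(q, r)) :
  adjoint (A *m B) = adjoint B *m adjoint A.
Proof.
apply/matrixP => i j; rewrite !mxE conj_sum; apply: eq_bigr => l _.
by rewrite !mxE conjM.
Qed.

Lemma adjointK p q (A : 'M[F]_(p, q)) : adjoint (adjoint A) = A.
Proof. by apply/matrixP => i j; rewrite !mxE conjK. Qed.

Lemma conj1 : scalar_conj (1 : F) = 1.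
Proof. by apply: tau_rc_inj; rewrite /= tau_conj tau1 trmx1. Qed.

Lemma adjoint_delta n (j : 'I_n) : adjoint (delta_mx 0 j : 'rV[F]_n) = delta_mx j 0.
Proof.
by apply/matrixP => a b; rewrite !mxE andbC; case: (_ && _); rewrite ?conj1 ?conj0.
Qed.

Lemma hermitianE n (x y : 'rV[F]_n) : Defs.hermitian x y = (x *m adjoint y) 0 0.
Proof. by rewrite !mxE; apply: eq_bigr => i _; rewrite mxE. Qed.

Definition blocks p q (A : 'M[F]_(p, q)) :=
  \mxblock_(i < p, j < q) (tau (rc (A i j)) : 'M[R]_d).

Lemma blocks_inj p q : injective (@blocks p q).
Proof.
rewrite /blocks => A B /eq_mxblockP AB; apply/matrixP => i j.
exact: tau_rc_inj (AB i j).
Qed.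

Lemma blocksM p q r (A : 'M[F]_(p, q)) (B : 'M[F]_(q, r)) :
  blocks (A *m B) = blocks A *m blocks B.
Proof.
rewrite /blocks mul_mxblock; apply/eq_mxblockP => i j.
rewrite mxE rc_sum linear_sum; apply: eq_bigr => l _; exact: tauM.
Qed.

Lemma blocks_adjoint p q (A : 'M[F]_(p, q)) : blocks (adjoint A) = (blocks A)^T.
Proof. by rewrite /blocks tr_mxblock; apply/eq_mxblockP => i j; rewrite mxE tau_conj. Qed.

Lemma blocks1 n : blocks (1%:M : 'M[F]_n) = 1%:M.
Proof.
rewrite -mxdiagZ; apply/eq_mxblockP => i j; rewrite mxE.
by case: (i == j) => /=; rewrite ?conform_mx_id ?tau1 // rc0 linear0.
Qed.

(** Any real row vector is the coordinate vector of a row [c] of scalars, and its product with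
    [blocks A] is the coordinate vector of [c *m A]. *)
Lemma blocks_row_free p q (A : 'M[F]_(p, q)) :
  (forall c : 'rV_p, c *m A = 0 -> c = 0) -> row_free (blocks A).
Proof.
move=> A0; apply: inj_row_free => w.
pose c : 'rV[F]_p := \row_i inv (submxrow w i).
have wE : w = \mxrow_i rc (c 0 i).
  by rewrite -[LHS]submxrowK; apply/eq_mxrowP => i; rewrite mxE invK.
rewrite wE mul_mxrow_mxblock -mxrow0 => /eq_mxrowP cA.
have /matrixP c0 : c = 0.
  apply: A0; apply/matrixP => a j; rewrite ord1 mxE; apply: (can_inj rcK).
  rewrite rc_sum mxE rc0 -[RHS](cA j); apply: eq_bigr => i _; exact: rcM.
by rewrite -mxrow0; apply/eq_mxrowP => i; rewrite c0 mxE rc0.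
Qed.

Lemma real_dim_gt0 : (0 < d)%N. Proof. by case: k. Qed.

(* A basis is an independent family of maximal size; sizes are bounded by [n]
   because real ranks are. *)
Lemma idempotent_subspace n (P : 'M[F]_n) : P *m P = P ->
  exists2 r, (r <= n)%N & subspace_of_dim r (range (fun x : 'rV_n => x *m P)).
Proof.
move=> PP.
pose Q r := `[< exists B : 'M[F]_(r, n), B *m P = B /\
  forall c : 'rV_r, c *m B = 0 -> c = 0 >].
have Q0 : exists r, Q r.
  exists 0%N; apply/asboolP; exists 0; split; first by rewrite mul0mx.
  by move=> c _; apply/matrixP => i [].
have Qn r : Q r -> (r <= n)%N.
  move=> /asboolP [B [_ B0]]; have := blocks_row_free B0.
  rewrite /row_free => /eqP rB; have := rank_leq_col (blocks B).
  by rewrite rB !sum_nat_const !card_ord leq_pmul2r // real_dim_gt0.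
case: (ex_maxnP Q0 Qn) => r /[dup] /Qn rn /asboolP [B [BP B0]] rmax.
exists r => //; exists B; split => //; apply/seteqP; split; last first.
  by move=> _ [c _ <-]; exists (c *m B); rewrite // -mulmxA BP.
move=> _ [x _ <-]; apply: contrapT => nx.
suff /rmax : Q (1 + r)%N by rewrite add1n ltnn.
apply/asboolP; exists (col_mx (x *m P) B); split.
  by rewrite mul_col_mx BP -mulmxA PP.
move=> c; rewrite -[c]hsubmxK mul_row_col => cB.
set a := lsubmx c in cB *; set b := rsubmx c in cB *.
(* A nonzero coefficient of the new vector could be inverted on the left, which would put that
   vector in the span of [B]. *)
have a0 : a 0 0 = 0.
  apply: contrapT => /eqP /F_inv [y ya]; apply: nx.
  exists (- (y *: b)) => //=.
  have := congr1 (fun M => y *: M) cB; rewrite scaler0 scalerDr !scalemxAl.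
  have -> : y *: a = 1%:M.
    by apply/matrixP => i j; rewrite !ord1 [LHS]mxE ya mxE eqxx.
  by rewrite mul1mx => /eqP; rewrite addr_eq0 mulNmx => /eqP ->.
have az : a = 0 by apply/matrixP => i j; rewrite !ord1 a0 mxE.
move: cB; rewrite az mul0mx add0r => /B0 ->; exact: row_mx0.
Qed.

(** Orthogonality tested on basis vectors says [(1 - P) *m adjoint P = 0]. So [adjoint P] equals
    [P *m adjoint P], which is self-adjoint; hence [P] is self-adjoint, then idempotent. *)
Lemma projection_sym_idem n (U : set 'rV[F]_n) (P : 'M[F]_n) :
  orthogonal_projection U P -> P *m P = P /\ adjoint P = P.
Proof.
move=> UP.
have PA : adjoint P = P *m adjoint P.
  apply/eqP; rewrite -subr_eq0 -{1}[adjoint P]mul1mx -mulmxBl.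
  set A := _ *m _; apply/eqP/matrixP => i j; rewrite [RHS]mxE.
  have [_ h] := UP (delta_mx 0 i); have [Uy _] := UP (delta_mx 0 j).
  have := h _ Uy; rewrite hermitianE adjointM adjoint_delta.
  rewrite -{1}[delta_mx 0 i]mulmx1 -mulmxBr mulmxA -(mulmxA _ _ (adjoint P)).
  by rewrite -rowE -colE 2!mxE.
have Pa : P = P *m adjoint P by rewrite -{1}[P]adjointK {1}PA adjointM adjointK.
have aP : adjoint P = P by rewrite PA -Pa.
by split=> //; rewrite -{2}aP -Pa.
Qed.

Lemma sym_idem_projection n (P : 'M[F]_n) : P *m P = P -> adjoint P = P ->
  orthogonal_projection (range (fun x : 'rV_n => x *m P)) P.
Proof.
move=> PP aP x; split; first by exists x.
move=> _ [y _ <-]; rewrite hermitianE adjointM aP mulmxA mulmxBl -mulmxA PP.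
by rewrite subrr mul0mx mxE.
Qed.

(** The map from [realify P] to [blocks P], expressed on real vectors so that its linearity over the
    reals makes sense. *)
Definition rv_blocks n (v : 'rV[R]_(n * n * d)) : 'M[R]_(\sum_(i < n) d) :=
  \mxblock_(i, j) tau (row (mxvec_index i j) (vec_mx v)).

Lemma rv_blocks_linear n : linear (@rv_blocks n).
Proof.
by move=> a v w; apply/matrixP => s t; rewrite [LHS]mxE !linearP !mxE.
Qed.

Lemma rv_blocks_realify n (P : 'M[F]_n) : rv_blocks (realify P) = blocks P.
Proof.
apply/eq_mxblockP => i j; congr (tau _); rewrite /realify mxvecK.
by apply/matrixP => a b; rewrite ord1 !mxE mxvecE.
Qed.

Lemma rv_blocks_inj n : injective (@rv_blocks n).
Proof.
rewrite /rv_blocks => v w /eq_mxblockP vw; apply: (can_inj vec_mxK).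
apply/row_matrixP => u; case/mxvec_indexP: u => i j; exact: tau_inj.
Qed.

Lemma realify_surj n (v : 'rV[R]_(n * n * d)) : exists P : 'M[F]_n, realify P = v.
Proof.
exists (\matrix_(i, j) inv (row (mxvec_index i j) (vec_mx v))).
apply: rv_blocks_inj; rewrite rv_blocks_realify; apply/eq_mxblockP => i j.
by rewrite mxE invK.
Qed.

End Realification.

(** In the subring of block matrices the union of the Grassmannians over all ranks is cut out by
    symmetry and idempotence, with no condition on the rank. *)
Theorem grassmannian_sym_idem (R : realType) (k : base_field) (n : nat) :
  exists (D : nat) (rho : {linear 'rV[R]_(n * n * real_dim k) -> 'M[R]_D})
    (lam : {linear 'M[R]_D -> 'rV[R]_(n * n * real_dim k)}),
  [/\ cancel rho lam, range rho 1%:M,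
      forall A B, range rho A -> range rho B -> range rho (A *m B),
      forall A, range rho A -> range rho A^T &
      forall v, (\bigcup_(r in [set r | (r <= n)%N]) @grassmannian_set R k n r) v <->
        sym_idem (rho v)].
Proof.
have [tau [inv [[invK rcK] rcD rcM tauC F_inv]]] := @regular_representation R k.
pose f := @rv_blocks R k tau n.
have lf : linear f by exact: rv_blocks_linear.
pose rho : {linear 'rV[R]_(n * n * real_dim k) -> 'M[R]_(\sum_(i < n) real_dim k)} :=
  HB.pack f (GRing.isLinear.Build _ _ _ _ f lf).
have rhoE (P : 'M[Defs.scalar R k]_n) :
    rho (realify P) = blocks tau P by exact: rv_blocks_realify.
have [lam lamK] : exists lam : {linear _ -> _}, cancel rho lam.
  by apply: linear_left_inverse; exact: (rv_blocks_inj invK rcM).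
have surj v : exists P : 'M[Defs.scalar R k]_n, realify P = v.
  exact: (realify_surj invK rcM).
have rhoP A : range rho A <-> exists P : 'M[Defs.scalar R k]_n, blocks tau P = A.
  split=> [[v _ <-]|[P <-]]; last by exists (realify P).
  by have [P <-] := surj v; exists P.
exists (\sum_(i < n) real_dim k)%N, rho, lam; split => //.
- by apply/rhoP; exists 1%:M; rewrite (blocks1 invK).
- move=> A B /rhoP [P <-] /rhoP [Q <-]; apply/rhoP.
  by exists (P *m Q); rewrite (blocksM invK).
- by move=> A /rhoP [P <-]; apply/rhoP; exists (adjoint P); rewrite blocks_adjoint.
have inj := blocks_inj invK rcK rcM.
move=> v; split.
  move=> [r _ [P [U _ UP] <-]]; rewrite rhoE.
  have [PP aP] := projection_sym_idem invK rcK rcD rcM tauC UP.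
  by split; rewrite -?blocks_adjoint // ?aP // -(blocksM invK) // PP.
have [P <-] := surj v; rewrite rhoE => -[aP PP].
have {}aP : adjoint P = P by apply: inj; rewrite blocks_adjoint.
have {}PP : P *m P = P by apply: inj; rewrite (blocksM invK).
have [r rn Ur] := idempotent_subspace invK rcK rcD rcM F_inv PP.
exists r => //; exists P => //.
exists (range (fun x : 'rV[Defs.scalar R k]_n => x *m P)) => //.
exact: (sym_idem_projection invK rcK rcD rcM tauC).
Qed.

(** * Regular maps and the Euclidean topology *)

Section RationalFunctions.
Context {R : realType} {m : nat}.
Implicit Types a b g h : 'rV[R]_m -> R.

Lemma algebraic_polyfun (Q : set ('rV[R]_m -> R)) : (forall g, Q g -> polyfun g) ->
  algebraic [set z | forall g, Q g -> g z = 0].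
Proof.
move=> Qp; exists [set p | exists2 g, Q g & forall z, g z = mpoly.meval (z 0) p].
apply/seteqP; split=> z /= h.
  by move=> p [g Qg gp]; rewrite -gp; apply: h.
by move=> g Qg; have [p gp] := Qp g Qg; rewrite gp; apply: h; exists g.
Qed.

(* Rational functions whose denominator is a power of [b]. *)
Definition ratfun b g := exists (a : 'rV[R]_m -> R) (e : nat),
  polyfun a /\ forall z, b z != 0 -> g z = a z / b z ^+ e.

Variable b : 'rV[R]_m -> R.
Hypothesis b_poly : polyfun b.

Lemma polyfunX f n : polyfun f -> polyfun (fun z : 'rV[R]_m => f z ^+ n).
Proof.
move=> pf; elim: n => [|n IH]; first exact: polyfun_cst.
by under eq_fun do rewrite exprS; apply: polyfunM.
Qed.

Lemma ratfun_cst c : ratfun b (fun=> c).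
Proof.
by exists (fun=> c), 0%N; split; [exact: polyfun_cst | move=> z _; rewrite divr1].
Qed.

Lemma ratfunD g h : ratfun b g -> ratfun b h -> ratfun b (fun z => g z + h z).
Proof.
move=> [a [e [pa ga]]] [c [f [pc hc]]].
exists (fun z => a z * b z ^+ f + c z * b z ^+ e), (e + f)%N; split.
  by apply: polyfunD; apply: polyfunM => //; apply: polyfunX.
move=> z bz; rewrite ga // hc // exprD; field; by rewrite !expf_neq0.
Qed.

Lemma ratfunM g h : ratfun b g -> ratfun b h -> ratfun b (fun z => g z * h z).
Proof.
move=> [a [e [pa ga]]] [c [f [pc hc]]].
exists (fun z => a z * c z), (e + f)%N; split; first exact: polyfunM.
by move=> z bz; rewrite ga // hc // exprD; field; rewrite !expf_neq0.
Qed.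

Lemma ratfun_meval n (G : 'rV[R]_m -> 'rV[R]_n) (p : mpoly.mpoly n R) :
  (forall i, ratfun b (fun z => G z 0 i)) ->
  ratfun b (fun z => mpoly.meval (G z 0) p).
Proof.
move=> rG; rewrite /mpoly.meval /mpoly.mmap.
elim: (mpoly.msupp p) => [|c s IH].
  by under eq_fun do rewrite big_nil; apply: ratfun_cst.
under eq_fun do rewrite big_cons; apply: ratfunD => //.
apply: ratfunM; first exact: ratfun_cst.
rewrite /mpoly.mmap1; elim: (index_enum _) => [|i r IHr].
  by under eq_fun do rewrite big_nil; apply: ratfun_cst.
under eq_fun do rewrite big_cons; apply: ratfunM => //.
have rX k : ratfun b (fun z => G z 0 i ^+ k).
  elim: k => [|k IHk]; first exact: ratfun_cst.
  by under eq_fun do rewrite exprS; apply: ratfunM.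
exact: rX.
Qed.

End RationalFunctions.

(** * Varieties in affine coordinates *)

Section Varieties.
Context {R : realType}.

(** A basic Euclidean open set is a finite intersection of preimages under global regular functions,
    so convergence may be tested on these preimages. *)
Lemma fspace_cvg (S : fspace R) (F : set_system S) (v : S) : Filter F ->
  (forall f O, regfun setT f -> open O -> O (f v) -> F (f @^-1` O)) -> F --> v.
Proof.
move=> FF Fv A; rewrite nbhsE => -[_ [ [B sB <-] [C BC Cv] ] sUBA].
rewrite nbhs_filterE; apply: filterS sUBA _; apply: (@filterS _ _ _ C).
  by move=> ? ?; exists C.
have /sB [D sD IDeC] := BC; rewrite -IDeC; apply: filter_bigI => E DE.
have /sD := DE; rewrite inE => - [f [W [rf oW EW]]]; rewrite EW.
apply: Fv => //; have : E v by move: Cv; rewrite -IDeC => /(_ _ DE).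
by rewrite EW.
Qed.

Lemma regfun_continuous (S : fspace R) (f : S -> R) : regfun setT f -> continuous f.
Proof.
move=> rf; apply/continuousP => O oO; exists [set f @^-1` O].
  by move=> _ ->; apply: (@finI_from1 _ _ _ id); exists f, O.
by rewrite predeqE => x; split=> [[_ ->]|] //; exists (f @^-1` O).
Qed.

(** What is retained of an isomorphism with an algebraic set: an injection, continuous for the
    Zariski topologies, through which quotients of polynomials are regular. *)
Definition coordinatization (S : fspace R) m (iota : S -> 'rV[R]_m) :=
  [/\ injective iota,
      forall B, algebraic B -> zopen (iota @^-1` (~` B)) &
      forall a b, polyfun a -> polyfun b ->
        regfun [set z | b (iota z) != 0] (fun z => a (iota z) / b (iota z))].

Lemma subfspace_coordinates m (A : set (affine_space R m)) :
  coordinatization (S := subfspace A) (fun z => set_val z : 'rV[R]_m).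
Proof.
split.
- by move=> x y; apply: val_inj.
- by move=> B aB; exists (~` B) => //=; rewrite setCK.
move=> a b [p ap] [q bq] x /= bx.
have aq : algebraic (~` [set z : 'rV[R]_m | b z != 0]).
  exists [set q]; apply/seteqP; split=> z /=.
    by move=> /negP; rewrite negbK => /eqP bz _ ->; rewrite -bq.
  by move=> /(_ q erefl) qz; rewrite bq qz eqxx.
exists [set z | b z != 0], (fun z => a z / b z); split=> //.
move=> z bz; exists [set z | b z != 0], p, q; split => // y by_ _.
by rewrite -ap -bq.
Qed.

Lemma variety_coordinates (V : fspace R) : real_algebraic_variety V ->
  exists m (iota : V -> 'rV[R]_m), coordinatization iota.
Proof.
move=> [m [A [_ [f [g [fK gK mf mg]]]]]]; exists m, (fun z => set_val (f z)).
have [inj za ra] := subfspace_coordinates A.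
split.
- by move=> x y /inj; apply: can_inj fK _ _.
- by move=> B /za /mf [].
move=> a b pa pb; have zb : zopen [set z : subfspace A | b (set_val z) != 0].
  rewrite (_ : [set z | _] = (fun z : subfspace A => set_val z : 'rV[R]_m) @^-1`
    (~` [set z | forall h, [set b] h -> h z = 0])).
    by apply: za; apply: algebraic_polyfun => h ->.
  apply/seteqP; split=> z /=; first by move=> bz /(_ b erefl) /eqP; apply/negP.
  by move=> h; apply/eqP => bz; apply: h => h ->.
by have [_ /(_ _ (ra a b pa pb))] := mf _ zb.
Qed.

Lemma algebraic_compl_basis N (B : set 'rV[R]_N) x : algebraic (~` B) -> B x ->
  exists2 p, mpoly.meval (x 0) p != 0 &
    forall y : 'rV[R]_N, mpoly.meval (y 0) p != 0 -> B y.
Proof.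
move=> [I BI] Bx.
have [p [Ip px]] : exists p, I p /\ mpoly.meval (x 0) p != 0.
  apply: contrapT => /forallNP h; have : (~` B) x; last by [].
  rewrite BI => p Ip; apply/eqP/negPn/negP => px; exact: (h p).
exists p => // y py; apply: contrapT => nBy; move: (nBy : (~` B) y); rewrite BI.
by move=> /(_ p Ip) /eqP; apply/negP.
Qed.

Section Coordinates.
Context {S : fspace R} {m : nat} {iota : S -> 'rV[R]_m}.
Hypothesis iotaP : coordinatization iota.

Lemma zopen_polyfun (Q : set ('rV[R]_m -> R)) : (forall g, Q g -> polyfun g) ->
  zopen [set z | exists2 g, Q g & g (iota z) != 0].
Proof.
move=> Qp; have [_ za _] := iotaP.
rewrite (_ : [set z | _] = iota @^-1` (~` [set z | forall g, Q g -> g z = 0])).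
  by apply: za; apply: algebraic_polyfun.
apply/seteqP; split=> z /=.
  by move=> [g Qg gz] /(_ g Qg) /eqP; apply/negP.
move=> /existsNP [g /not_implyP [Qg gz]]; exists g => //; exact/eqP.
Qed.

Lemma zopen_neq0 b : polyfun b -> zopen [set z | b (iota z) != 0].
Proof.
move=> pb; rewrite (_ : [set z | _] = [set z | exists2 g, g = b & g (iota z) != 0]).
  by apply: zopen_polyfun => g ->.
apply/seteqP; split=> z /=; first by exists b.
by move=> [_ ->].
Qed.

Lemma polyfun_iota_continuous g : polyfun g -> continuous (fun z => g (iota z)).
Proof.
move=> pg; apply: regfun_continuous; have [_ _ ra] := iotaP.
have := ra g (fun=> 1) pg (polyfun_cst 1).
rewrite (_ : [set z | _] = setT); last by apply/seteqP; split=> z //= _; rewrite oner_eq0.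
by under eq_fun do rewrite divr1.
Qed.

Lemma iota_continuous i : continuous (fun z => iota z 0 i).
Proof. exact: (polyfun_iota_continuous (polyfun_coord i)). Qed.

(** A polynomial in the coordinates of [F] is a polynomial over a power of [b], and [b] has no zero
    on [Z]. Its nonvanishing locus is therefore open, and local quotients pull back to local
    quotients. *)
Lemma rational_morphism (Z : set S) N (G : set (affine_space R N))
    (F : subfspace Z -> subfspace G) (a : 'I_N -> 'rV[R]_m -> R) b :
  polyfun b -> (forall i, polyfun (a i)) ->
  (forall z : subfspace Z, b (iota (set_val z)) != 0 /\
     forall i, (set_val (F z) : 'rV[R]_N) 0 i =
       a i (iota (set_val z)) / b (iota (set_val z))) ->
  morphism F.
Proof.
move=> pb pa Fab.
pose G0 y : 'rV[R]_N := \row_i (a i y / b y).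
have rG p : ratfun b (fun y => mpoly.meval (G0 y 0) p).
  apply: ratfun_meval => // i; exists (a i), 1%N; split => // y _.
  by rewrite mxE expr1.
have FG z : (set_val (F z) : 'rV[R]_N) = G0 (iota (set_val z)).
  by apply/matrixP => u i; rewrite ord1 mxE (Fab z).2.
have /choice [P /choice [e PE]] := rG.
have FE z p : mpoly.meval ((set_val (F z) : 'rV[R]_N) 0) p =
    P p (iota (set_val z)) / b (iota (set_val z)) ^+ e p.
  by rewrite FG (PE p).2 // (Fab z).1.
have be (z : subfspace Z) n : b (iota (set_val z)) ^+ n != 0.
  by rewrite expf_neq0 // (Fab z).1.
have F0 (z : subfspace Z) p : (mpoly.meval ((set_val (F z) : 'rV[R]_N) 0) p != 0) =
    (P p (iota (set_val z)) != 0).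
  by rewrite FE mulf_eq0 invr_eq0 (negPf (be _ _)) orbF.
move=> _ [W [I WI] ->]; split.
  exists [set z | exists2 g, (exists2 p, I p & g = P p) & g (iota z) != 0].
    by apply: zopen_polyfun => g [p _ ->]; have [] := PE p.
  apply/seteqP; split=> z /=.
    move=> Wz; apply: contrapT => nz; have : (~` W) (set_val (F z)); last by [].
    rewrite WI => p Ip; apply/eqP/negPn/negP => pz; apply: nz.
    by exists (P p); [exists p | rewrite -F0].
  move=> [_ [p Ip ->]]; rewrite -F0 => pz; apply: contrapT => nWz.
  move: (nWz : (~` W) (set_val (F z))); rewrite WI => /(_ p Ip) /eqP.
  exact/negP.
have algW : algebraic (~` W) by exists I.
move=> h rh z /= Wz; have [W' [g [aW' W'z rg hg]]] := rh (F z) Wz.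
have [B [p [q [aB Bz gpq]]]] := rg _ W'z.
have [p1 p1z p1W] := algebraic_compl_basis aW' W'z.
have [p2 p2z p2B] := algebraic_compl_basis aB Bz.
have [qz _] := gpq _ Bz W'z.
have [_ _ ra] := iotaP.
(* The factors [P p1] and [P p2] confine the nonvanishing of [den] to the region where both local
   formulas, for [h] and for [g], are valid; they cancel in the quotient. *)
pose den y := P q y * b y ^+ e p * (P p1 y * P p2 y).
pose num y := P p y * b y ^+ e q * (P p1 y * P p2 y).
have pP r : polyfun (P r) by have [] := PE r.
have pden : polyfun den.
  by apply: polyfunM; apply: polyfunM => //; exact: polyfunX.
have pnum : polyfun num.
  by apply: polyfunM; apply: polyfunM => //; exact: polyfunX.
exists [set y | den (iota y) != 0], (fun y => num (iota y) / den (iota y)).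
split; [exact: zopen_neq0 | | exact: ra |].
  by rewrite /= !mulf_neq0 // -?F0.
move=> y Wy /=; rewrite !mulf_eq0 !negb_or => /andP[/andP[qy _] /andP[p1y p2y]].
have W'y : W' (set_val (F y)) by apply: p1W; rewrite F0.
have By : B (set_val (F y)) by apply: p2B; rewrite F0.
rewrite hg //; have [_ ->] := gpq _ By W'y; rewrite !FE /num /den.
field; by rewrite p1y p2y qy !be.
Qed.

End Coordinates.

End Varieties.

(** * Euclidean neighbourhoods measured in coordinates *)

Section UniformNeighbourhoods.
Context {R : realType}.

Definition entry_ball m n (v : 'M[R]_(m, n)) (e : R) : set 'M[R]_(m, n) :=
  [set w | forall i j, `|w i j - v i j| < e].

Lemma entry_ball_filter (W : Type) m n (A : W -> 'M[R]_(m, n)) v :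
  Filter (filter_from [set e : R | 0 < e] (fun e => A @^-1` entry_ball v e)).
Proof.
apply: filter_from_filter; first by exists 1 => /=.
move=> d e /= d0 e0; exists (Num.min d e); first by rewrite /= lt_min d0.
by move=> w h; split=> i j; apply: lt_le_trans (h i j) _; rewrite ge_min lexx ?orbT.
Qed.

Lemma mlim_entry_ball (W : Type) m n (A : W -> 'M[R]_(m, n)) v :
  mlim (filter_from [set e : R | 0 < e] (fun e => A @^-1` entry_ball v e)) A v.
Proof.
have FF := entry_ball_filter A v.
move=> i j; apply/cvgrPdist_lt => e e0; exists e => // w h.
by rewrite distrC; apply: h.
Qed.

(** Continuity at 0, made uniform by linearity. *)
Lemma linear_entry_ball m n p q (f : {linear 'M[R]_(m, n) -> 'M[R]_(p, q)}) (d : R) :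
  0 < d -> exists2 e : R, 0 < e &
    forall A B, entry_ball B e A -> entry_ball (f B) d (f A).
Proof.
move=> d0; have FF := @entry_ball_filter _ m n id 0.
have fl := mlim_linear (FF := FF) (f := f) (@mlim_entry_ball _ m n id 0).
have : \forall C \near filter_from [set e : R | 0 < e]
      (fun e => id @^-1` entry_ball (0 : 'M[R]_(m, n)) e),
    forall i j, `|f 0 i j - f C i j| < d.
  apply: filter_forall => i; apply: filter_forall => j.
  by have /cvgrPdist_lt /(_ d d0) := fl i j.
move=> [e e0 eP]; exists e => // A B AB i j.
have := eP (A - B) _ i j; rewrite linear0 linearB !mxE sub0r normrN; apply.
by move=> a b; have := AB a b; rewrite !mxE subr0.
Qed.

(* Global regular functions are only locally quotients of polynomials, which are
   continuous in the coordinates. *)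
Lemma subfspace_nbhs N (G : set (affine_space R N)) (v : subfspace G)
    (U : set (subfspace G)) : nbhs v U ->
  exists2 e : R, 0 < e & forall w : subfspace G,
    entry_ball (set_val v : 'rV[R]_N) e (set_val w) -> U w.
Proof.
pose val (w : subfspace G) : 'rV[R]_N := set_val w.
have FF := entry_ball_filter val (val v).
have vl := @mlim_entry_ball _ _ _ val (val v).
set F := filter_from _ _ in FF vl.
suff Fv : F --> v by move=> /Fv [e e0 eU]; exists e.
apply: fspace_cvg => f W rf oW Wv.
have [B [g [aB Bv rg fg]]] := rf v I.
have [C [p [q [aC Cv gpq]]]] := rg _ Bv.
have [qv gv] := gpq _ Cv Bv.
have mev r : mpoly.meval (val w 0) r @[w --> F] --> mpoly.meval (val v 0) r.
  by apply: (@polyfun_lim _ _ _ _ _ (fun z => mpoly.meval (z 0) r)) => //; exists r.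
have nz r : mpoly.meval (val v 0) r != 0 ->
    \forall w \near F, mpoly.meval (val w 0) r != 0.
  by move=> rv; apply: (cvgr_neq0 _ (mev r)).
have [p1 p1v p1B] := algebraic_compl_basis aB Bv.
have [p2 p2v p2C] := algebraic_compl_basis aC Cv.
have fl : f w @[w --> F] --> f v.
  rewrite fg // gv.
  apply: (@cvg_trans _
    ((fun w => mpoly.meval (val w 0) p / mpoly.meval (val w 0) q) @ F)).
    apply: near_eq_cvg; near=> w.
    have w1 : B (set_val w) by apply: p1B; near: w; exact: nz.
    have w2 : C (set_val w) by apply: p2C; near: w; exact: nz.
    by rewrite fg //; have [_ ->] := gpq _ w2 w1.
  by apply: cvgM => //; apply: cvgV.
by apply: fl; apply: open_nbhs_nbhs.
Unshelve. all: end_near. Qed.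

Lemma subfspace_continuous (T : topologicalType) N (G : set (affine_space R N))
    (h : T -> subfspace G) :
  (forall x, mlim (nbhs x) (fun y => set_val (h y) : 'rV[R]_N) (set_val (h x))) ->
  continuous h.
Proof.
move=> hl x U /subfspace_nbhs [e e0 eU]; rewrite nbhs_filterE /=.
have : \forall y \near x, entry_ball (set_val (h x) : 'rV[R]_N) e (set_val (h y)).
  apply: filter_forall => i; apply: filter_forall => j.
  have /cvgrPdist_lt /(_ e e0) := hl x i j.
  by apply: filterS => y; rewrite distrC.
by apply: filterS => y; apply: eU.
Qed.

Lemma subfspace_continuous_coord (T : topologicalType) N (G : set (affine_space R N))
    (h : T -> subfspace G) x : continuous h ->
  mlim (nbhs x) (fun y => set_val (h y) : 'rV[R]_N) (set_val (h x)).
Proof.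
move=> ch i j; rewrite ord1.
apply: (cvg_comp h (fun w : subfspace G => (set_val w : 'rV[R]_N) 0 j)); first exact: ch.
exact: (iota_continuous (subfspace_coordinates G)).
Qed.

(** Uniformly close maps converge for the compact-open topology: if [f] sends a compact set into an
    open [W], some uniform margin around its values stays inside [W]. *)
Lemma cmaps_uniform (T : topologicalType) N (G : set (affine_space R N))
    (f : cmaps T (subfspace G)) (U : set (cmaps T (subfspace G))) : nbhs f U ->
  exists2 e : R, 0 < e & forall g : cmaps T (subfspace G),
    (forall x, entry_ball (set_val ((f : T -> _) x) : 'rV[R]_N) e
       (set_val ((g : T -> _) x))) -> U g.
Proof.
pose F := filter_from [set e : R | 0 < e] (fun e => [set g : cmaps T (subfspace G) |
  forall x, entry_ball (set_val ((f : T -> _) x) : 'rV[R]_N) e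
    (set_val ((g : T -> _) x))]).
have FF : Filter F.
  apply: filter_from_filter; first by exists 1 => /=.
  move=> d e /= d0 e0; exists (Num.min d e); first by rewrite /= lt_min d0.
  by move=> w h; split=> x i j; apply: lt_le_trans (h x i j) _; rewrite ge_min lexx ?orbT.
have cf : continuous (f : T -> subfspace G) by apply: cts_fun.
suff Ff : ((fun g : cmaps T (subfspace G) => (g : T -> subfspace G)) @ F :
    set_system {compact-open, T -> subfspace G}) -->
    (f : {compact-open, T -> subfspace G}).
  rewrite nbhsE => -[_ [[B oB <-] Bf] BU].
  have /Ff [e e0 eB] : nbhs (f : {compact-open, T -> subfspace G}) B.
    by apply: open_nbhs_nbhs.
  by exists e => // g /eB /BU.
apply/compact_open_cvgP => K W cK oW fKW.
have : \forall e \near 0^'+, K `<=` [set x | forall w : subfspace G,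
    entry_ball (set_val ((f : T -> _) x) : 'rV[R]_N) e (set_val w) -> W w].
  move/compact_near_coveringP : cK; apply => x Kx.
  have /subfspace_nbhs [d d0 dW] : nbhs ((f : T -> _) x) W.
    by apply: open_nbhs_nbhs; split => //; apply: fKW; exists x.
  have d20 : 0 < d / 2 by rewrite divr_gt0.
  have n1 : \forall y \near x, entry_ball (set_val ((f : T -> _) x) : 'rV[R]_N) (d / 2)
      (set_val ((f : T -> _) y)).
    apply: filter_forall => i; apply: filter_forall => j.
    have /cvgrPdist_lt /(_ _ d20) := @subfspace_continuous_coord _ _ _ _ x cf i j.
    by apply: filterS => y; rewrite distrC.
  exists ([set y | entry_ball (set_val ((f : T -> _) x) : 'rV[R]_N) (d / 2)
      (set_val ((f : T -> _) y))], [set e | e < d / 2]).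
    by split => //=; apply: nbhs_right_lt.
  move=> [y e] /= [fy ed] w wy; apply: dW => i j; rewrite [d]splitr.
  apply: le_lt_trans (ler_distD ((set_val ((f : T -> _) y) : 'rV[R]_N) i j) _ _) _.
  by apply: ltrD; [apply: lt_trans (wy i j) ed | exact: fy].
move=> KW; have : \forall e \near 0^'+, 0 < e /\ K `<=` [set x | forall w : subfspace G,
    entry_ball (set_val ((f : T -> _) x) : 'rV[R]_N) e (set_val w) -> W w].
  by near=> e; split; near: e => //; apply: nbhs_right_gt.
case/filter_ex => e [e0 eW]; exists e => // g ge _ [x Kx <-].
exact: eW Kx _ (ge x).
Unshelve. all: end_near. Qed.

End UniformNeighbourhoods.

(** * The stratification and the approximating map *)

Section Covering.
Context {R : realType}.

Lemma compact_set_type (S : topologicalType) (X : set S) :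
  compact X -> compact [set: X].
Proof.
move=> /compact_near_coveringP cX; apply/compact_near_coveringP => J F Q FF cov.
(* The property is moved to the ambient space by quantifying over the lifts of a point to the
   subtype. *)
have : \near F, X `<=` (fun v => forall x : X, set_val x = v -> Q F x).
  apply: cX => v Xv; pose x0 : X := SigSub (mem_set Xv).
  have [[U1 U2] [/= + FU2] UQ] := cov x0 I.
  rewrite nbhsE => -[_ [[W oW <-] Wx] WU].
  exists (W, U2); first by split => //; apply: open_nbhs_nbhs.
  move=> [w i] /= [Ww U2i] x xw; apply: (UQ (x, i)); split => //.
  by apply: WU; rewrite /= xw.
by apply: filterS => i h x _; apply: h (set_valP x) _ _.
Qed.

Definition sqdist_sub m (c : 'rV[R]_m) (r : R) (z : 'rV[R]_m) :=
  \sum_i (z 0 i - c 0 i) ^+ 2 - r.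

Lemma polyfun_sqdist_sub m (c : 'rV[R]_m) r : polyfun (sqdist_sub c r).
Proof.
apply: polyfunB; last exact: polyfun_cst.
apply: polyfun_sum => i; apply: polyfunX.
by apply: polyfunB; [exact: polyfun_coord | exact: polyfun_cst].
Qed.

Lemma sqdist_eq0 m (c z : 'rV[R]_m) : sqdist_sub c 0 z = 0 -> z = c.
Proof.
rewrite /sqdist_sub subr0 => h.
apply/matrixP => a i; rewrite ord1; apply/eqP; rewrite -subr_eq0 -sqrf_eq0.
by apply/eqP; exact: (psumr_eq0P (fun i _ => sqr_ge0 (z 0 i - c 0 i)) h).
Qed.

Context {T : topologicalType} {m : nat} (xi : T -> 'rV[R]_m).
Hypothesis T_compact : compact [set: T].
Hypothesis xi_cont : forall i, continuous (fun x => xi x 0 i).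
Hypothesis xi_inj : injective xi.

(* Compactness makes the topology of [T] the one induced by the coordinates. *)
Lemma closed_ball_basis c (U : set T) : nbhs c U ->
  exists2 r : R, 0 < r & [set x | sqdist_sub (xi c) r (xi x) <= 0] `<=` U.
Proof.
move=> cU.
have cd : continuous (fun x => sqdist_sub (xi c) 0 (xi x)).
  by apply: (polyfun_continuous xi_cont); exact: polyfun_sqdist_sub.
have : \forall r \near 0^'+,
    [set: T] `<=` [set x | sqdist_sub (xi c) 0 (xi x) <= r -> U x].
  move/compact_near_coveringP : T_compact; apply => x _.
  have [->|xc] := eqVneq x c.
    exists (U, setT); first by split => //; exact: filterT.
    by move=> [y r] [Uy _] _.
  have d0 : 0 < sqdist_sub (xi c) 0 (xi x).
    rewrite lt_def {2}/sqdist_sub subr0 sumr_ge0 ?andbT; last first.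
      by move=> i _; exact: sqr_ge0.
    by apply: contra_neq xc => /sqdist_eq0 /xi_inj.
  have d20 : sqdist_sub (xi c) 0 (xi x) / 2 < sqdist_sub (xi c) 0 (xi x) by lra.
  exists ([set y | sqdist_sub (xi c) 0 (xi x) / 2 < sqdist_sub (xi c) 0 (xi y)],
          [set r | r < sqdist_sub (xi c) 0 (xi x) / 2]).
    split => /=; first exact: (cvgr_gt _ (cd x)).
    by apply: nbhs_right_lt; lra.
  move=> [y r] /= [h1 h2] h3; exfalso; lra.
move=> h; have : \forall r \near 0^'+, 0 < r /\
    [set: T] `<=` [set x | sqdist_sub (xi c) 0 (xi x) <= r -> U x].
  by near=> r; split; near: r => //; apply: nbhs_right_gt.
case/filter_ex => r [r0 rU]; exists r => // x /= xr; apply: rU => //.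
by move: xr; rewrite /sqdist_sub subr0 subr_le0.
Unshelve. all: end_near. Qed.

(** Local contractibility with the whole space as target gives neighbourhoods contractible in it.
    Each contains a closed ball, and finitely many of the open balls cover. *)
Lemma contractible_cover : locally_contractible R T ->
  exists (k : nat) (u : nat -> 'rV[R]_m -> R),
  [/\ forall i, polyfun (u i), forall i z, (k <= i)%N -> u i z = 0,
      forall x, exists2 i, (i < k)%N & u i (xi x) <= 0 &
      forall i, (i < k)%N -> exists (Nb : set T) (H : T * R -> T) (c : T),
        [/\ [set x | u i (xi x) <= 0] `<=` Nb,
            {within Nb `*` [set` `[0, 1]], continuous H},
            forall x, Nb x -> H (x, 0) = x & forall x, Nb x -> H (x, 1) = c]].
Proof.
move=> lcT.
have /choice [r rP] : forall c : T, exists r : R, 0 < r /\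
    exists (Nb : set T) (H : T * R -> T) (c' : T),
        [/\ [set x | sqdist_sub (xi c) r (xi x) <= 0] `<=` Nb,
            {within Nb `*` [set` `[0, 1]], continuous H},
            forall x, Nb x -> H (x, 0) = x & forall x, Nb x -> H (x, 1) = c'].
  move=> c; have [Nb [Nc _ [H [c' [cH H0 H1 _]]]]] := lcT c setT filterT.
  have [r r0 rN] := closed_ball_basis Nc.
  by exists r; split => //; exists Nb, H, c'.
pose g c := sqdist_sub (xi c) (r c).
have [|s [_ sP]] := compact_finite_cover
  (U := fun c => [set x | g c (xi x) < 0]) T_compact.
  move=> c _; apply: (cvgr_lt (g c (xi c))).
    exact: (polyfun_continuous xi_cont (polyfun_sqdist_sub _ _)).
  rewrite /g /sqdist_sub big1 ?sub0r ?oppr_lt0 ?(rP c).1 // => i _.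
  by rewrite subrr expr0n.
(* The default is the zero function, so that [u i] is polynomial and vanishes for every index past
   the list. *)
pose u i := nth (fun=> 0) (map g s) i.
have uE i : (i < size s)%N -> exists c, u i = g c.
  rewrite /u; case: s {sP u} => // c0 s lti.
  by exists (nth c0 (c0 :: s) i); rewrite (nth_map c0).
exists (size s), u; split.
- move=> i; have [/uE [c ->]|si] := ltnP i (size s); first exact: polyfun_sqdist_sub.
  by rewrite /u nth_default ?size_map //; exact: polyfun_cst.
- by move=> i z si; rewrite /u nth_default ?size_map.
- move=> x; have [c cs /ltW cx] := sP x I; exists (index c s); first by rewrite index_mem.
  by rewrite /u (nth_map c) ?index_mem // nth_index.
- by move=> i /uE [c ->]; have [_] := rP c.
Qed.

End Covering.

(** * Strata defined by vanishing patterns *)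

Section Strata.
Context {R : realType} {S : fspace R} {m : nat} {iota : S -> 'rV[R]_m}.
Hypothesis iotaP : coordinatization iota.
Variables (k : nat) (u : nat -> 'rV[R]_m -> R).
Hypothesis u_poly : forall i, polyfun (u i).

Definition zero_stratum (A : {set 'I_k}) : set S :=
  [set z | forall i : 'I_k, (u i (iota z) == 0) = (i \in A)].

Lemma zero_stratification : stratification (range zero_stratum).
Proof.
split.
- exact: finite_image.
- move=> _ [A _ <-]; have pA : polyfun (fun z => \prod_(i | i \notin A) u i z).
    by apply: polyfun_prod.
  pose Q : set ('rV[R]_m -> R) := [set g | exists2 i : 'I_k, i \in A & g = u i].
  exists [set z | \prod_(i | i \notin A) u i (iota z) != 0],
    [set z | forall i, i \in A -> u i (iota z) = 0]; split.
  + exact: (zopen_neq0 iotaP pA).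
  + rewrite /zclosed (_ : ~` _ = [set z | exists2 g, Q g & g (iota z) != 0]).
      by apply: (zopen_polyfun iotaP) => _ [i _ ->].
    apply/seteqP; split=> z /=.
      move=> /existsNP [i /not_implyP [iA uz]].
      by exists (u i); [exists i | apply/eqP].
    by move=> [_ [i iA ->] uz] h; move: uz; rewrite h // eqxx.
  + apply/seteqP; split=> z /=.
      move=> h; split; last by move=> i; rewrite -h => /eqP.
      by apply/prodf_neq0 => i; rewrite -h.
    move=> [/prodf_neq0 h1 h2] i; case: (boolP (i \in A)) => iA.
      by rewrite h2 ?eqxx.
    by rewrite (negPf (h1 i iA)).
- move=> _ _ [A _ <-] [B _ <-] [z [zA zB]]; congr zero_stratum.
  by apply/setP => i; rewrite -zA -zB.
apply/seteqP; split=> // z _.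
exists (zero_stratum [set i : 'I_k | u i (iota z) == 0]%SET); first by eexists.
by move=> i; rewrite inE.
Qed.

(** A function [u i] with a zero on the component vanishes on all of it; otherwise the intermediate
    value theorem fixes its sign. The second clause lets an index chosen at [x] serve the whole
    component. *)
Lemma overshoot_polyfun (X : set S) (A : {set 'I_k}) (x : S) (i : nat) :
  (X `&` zero_stratum A) x -> (i < k)%N ->
  exists2 d, polyfun d &
    forall z, connected_component (X `&` zero_stratum A) x z ->
      overshoot u i (iota z) = d (iota z) /\
      (u i (iota x) <= 0 -> u i (iota z) <= 0).
Proof.
move=> Xx ik; set K := connected_component _ x.
have Kx : K x by exact: connected_component_refl.
have KA z : K z -> zero_stratum A z.
  by move=> /connected_component_sub [].
have [iA|iA] := boolP (Ordinal ik \in A).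
  have u0 z : K z -> u i (iota z) = 0.
    by move=> /KA /(_ (Ordinal ik)); rewrite iA => /eqP.
  exists (fun=> 0); first exact: polyfun_cst.
  by move=> z Kz; rewrite /overshoot u0 // maxxx lexx.
have u0 z : K z -> u i (iota z) != 0.
  by move=> /KA /(_ (Ordinal ik)); rewrite (negPf iA) => ->.
have cu : continuous (fun z => u i (iota z)) by exact: polyfun_iota_continuous.
have iu : is_interval [set u i (iota z) | z in K].
  apply/connected_intervalP; apply: connected_continuous_connected.
    exact: component_connected.
  exact: continuous_subspaceT.
have sgn z w : K z -> K w -> u i (iota z) <= 0 -> u i (iota w) <= 0.
  move=> Kz Kw uz; rewrite leNgt; apply/negP => uw.
  have [y Ky uy] : [set u i (iota z) | z in K] 0.
    by apply: (iu (u i (iota z)) (u i (iota w))); [exists z | exists w | rewrite uz ltW].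
  by have := u0 y Ky; rewrite uy eqxx.
have [ux|ux] := lerP (u i (iota x)) 0.
  exists (fun=> 0); first exact: polyfun_cst.
  by move=> z Kz; have uz := sgn _ _ Kx Kz ux; split => //; apply/max_idPl.
exists (u i); first exact: u_poly.
move=> z Kz; split; last by [].
apply/max_idPr; rewrite leNgt; apply/negP => /ltW uz.
by move: (sgn _ _ Kz Kx uz); rewrite leNgt ux.
Qed.

End Strata.

Section RangeOfFrames.
Context {R : realType} {N D : nat} (rho : {linear 'rV[R]_N -> 'M[R]_D})
  (lam : {linear 'M[R]_D -> 'rV[R]_N}).
Hypothesis rhoK : cancel rho lam.
Hypothesis rho1 : range rho 1%:M.
Hypothesis rhoM : forall A B, range rho A -> range rho B -> range rho (A *m B).
Hypothesis rho_tr : forall A, range rho A -> range rho A^T.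

Lemma rhoD A B : range rho A -> range rho B -> range rho (A + B).
Proof. by move=> [v _ <-] [w _ <-]; exists (v + w); rewrite ?linearD. Qed.

Lemma rho_scalar c : range rho c%:M.
Proof. by have [v _ vE] := rho1; exists (c *: v); rewrite // linearZ /= vE scalemx1. Qed.

Lemma range_frame k M d j : (forall i, range rho (M i)) -> range rho (frame k M d j).
Proof.
move=> rM; apply: rhoM => //; elim: (k - j.+1)%N => [|n IH] //=.
apply: rhoM => //; apply: rhoD; last exact: rho_scalar.
by apply: rhoM => //; exact: rho_tr.
Qed.

Lemma range_range_proj C E : range rho C -> range rho E -> gram C E \in unitmx ->
  range rho (range_proj C E).
Proof.
move=> rC rE Gu; apply: rhoM; last exact: rho_tr.
apply: rhoM => //; apply: range_invmx Gu => //.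
by apply: rhoD; [apply: rhoM => //; exact: rho_tr | exact: rhoB].
Qed.

End RangeOfFrames.

(** * Gluing the frames into a piecewise regular map *)

Section Assembly.
Context {R : realType} {V : fspace R} {m : nat} {iota : V -> 'rV[R]_m}.
Hypothesis iotaP : coordinatization iota.
Context {X : set V}.
Hypothesis X_compact : compact X.
Let xi (x : X) := iota (set_val x).

Lemma restrict_coord_continuous i : continuous (fun x : X => xi x 0 i).
Proof.
move=> x; apply: (cvg_comp (fun y : X => set_val y) (fun z => iota z 0 i)).
  exact: initial_continuous.
exact: (iota_continuous iotaP).
Qed.

Lemma restrict_coord_inj : injective xi.
Proof. by have [inj _ _] := iotaP; move=> x y /inj; exact: val_inj. Qed.

Variables (k : nat) (u : nat -> 'rV[R]_m -> R).
Hypothesis u_poly : forall i, polyfun (u i).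
Hypothesis u_out : forall i z, (k <= i)%N -> u i z = 0.
Hypothesis u_cover : forall x, exists2 i, (i < k)%N & u i (xi x) <= 0.
Hypothesis u_contractible : forall i, (i < k)%N ->
  exists (Nb : set X) (H : X * R -> X) (c : X),
    [/\ [set x | u i (xi x) <= 0] `<=` Nb,
        {within Nb `*` [set` `[0, 1]], continuous H},
        forall x, Nb x -> H (x, 0) = x & forall x, Nb x -> H (x, 1) = c].

Context {N D : nat} (rho : {linear 'rV[R]_N -> 'M[R]_D})
  (lam : {linear 'M[R]_D -> 'rV[R]_N}) (G : set 'rV[R]_N).
Hypothesis rhoK : cancel rho lam.
Hypothesis rho1 : range rho 1%:M.
Hypothesis rhoM : forall A B, range rho A -> range rho B -> range rho (A *m B).
Hypothesis rho_tr : forall A, range rho A -> range rho A^T.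
Hypothesis rhoG : forall v, G v <-> sym_idem (rho v).
Let GV := subfspace (S := affine_space R N) G.

Lemma sym_idem_point A : range rho A -> sym_idem A -> G (lam A).
Proof. by move=> [v _ <-]; rewrite rhoK rhoG. Qed.

Theorem piecewise_regular_approx (f : cmaps X GV) U : nbhs f U ->
  exists g : cmaps X GV,
    U g /\ piecewise_regular (range (@zero_stratum R V m iota k u)) (g : X -> GV).
Proof.
move=> /cmaps_uniform [e e0 eU].
have cf : continuous (f : X -> GV) by exact: cts_fun.
have cT := compact_set_type X_compact.
have cxi := restrict_coord_continuous.
pose P (x : X) := rho (set_val ((f : X -> GV) x)).
have Pp x : sym_idem (P x) by apply/rhoG; exact: set_valP.
have Pc x : mlim (nbhs x) P (P x).
  by apply: mlim_linear; exact: subfspace_continuous_coord.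
have rP x : range rho (P x) by eexists.
have [d d0 dP] := linear_entry_ball lam e0.
have [E [M [Ep Mp ME Cnear Ceq]]] := frame_approximation cT cxi restrict_coord_inj rhoK
  rho1 rhoM Pc Pp rP u_poly u_contractible d0.
pose C j z := frame k (M ^~ z) (overshoot u ^~ z) j.
have CE a z j : frame k (M ^~ z) a j *m E j = frame k (M ^~ z) a j.
  by rewrite -mulmxA ME.
have rC a z j : range rho (frame k (M ^~ z) a j).
  by apply: range_frame => // i; exact: (Mp i).2.
have rE j : range rho (E j) by exact: (Ep j).2.
have Eproj j : sym_idem (E j) by exact: (Ep j).1.
have /choice [J JP] : forall x, exists j, (j < k)%N /\ u j (xi x) <= 0.
  by move=> x; have [j] := u_cover x; exists j.
(* The choice of [J] is arbitrary and not continuous, but [hE] shows that the value does not depend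
   on it. *)
pose h x := range_proj (C (J x) (xi x)) (E (J x)).
have hE x j : (j < k)%N -> u j (xi x) <= 0 -> h x = range_proj (C j (xi x)) (E j).
  by move=> jk uj; apply: Ceq => //; case: (JP x).
have Cu x j : (j < k)%N -> u j (xi x) <= 0 -> gram (C j (xi x)) (E j) \in unitmx.
  by move=> jk uj; have [] := Cnear x j jk uj.
have hG x : G (lam (h x)).
  have [jk uj] := JP x; have Gu := Cu x _ jk uj.
  apply: sym_idem_point.
    exact: (range_range_proj rhoK rho1 rhoM rho_tr (rC _ _ _) (rE _) Gu).
  by have [] := range_projP (Eproj _) (CE _ _ _) Gu.
pose g (x : X) : GV := SigSub (mem_set (hG x)).
have gE x : set_val (g x) = lam (h x) by [].
have ovc i x : overshoot u i (xi y) @[y --> x] --> overshoot u i (xi x).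
  exact: (overshoot_continuous cxi u_poly).
have hc x : mlim (nbhs x) h (h x).
  move=> a b; apply/cvgrPdist_lt => r r0.
  (* Nearby points may use any of the finitely many indices: one with [u j] positive at [x] cannot
     occur near [x], and for the others the formula is continuous with value [h x] at [x]. *)
  have : \forall y \near x, forall j : 'I_k, u j (xi y) <= 0 ->
      `|h x a b - range_proj (C j (xi y)) (E j) a b| < r.
    suff hj (j : 'I_k) : \forall y \near x, u j (xi y) <= 0 ->
        `|h x a b - range_proj (C j (xi y)) (E j) a b| < r by exact: (filter_forall _ hj).
    have [uj|uj] := lerP (u j (xi x)) 0; last first.
      have : \forall y \near x, 0 < u j (xi y).
        by apply: (cvgr_gt _ (polyfun_continuous cxi (u_poly j) (x := x))).
      by apply: filterS => y; rewrite ltNge => /negP uy /uy.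
    have Ml i : mlim (nbhs x) (fun y => M i (xi y)) (M i (xi x)).
      move=> a' b'; exact: (polyfun_continuous cxi ((Mp i).1 a' b')).
    have FF : Filter (nbhs x) by exact: _.
    have Cl := mlim_frame (FF := FF) (k := k) (j := j) Ml (ovc ^~ x).
    have := mlim_range_proj (FF := FF) Cl (Cu x j (ltn_ord j) uj) (i := a) (j := b).
    rewrite -(hE x j (ltn_ord j) uj) => /cvgrPdist_lt /(_ r r0).
    by apply: filterS.
  apply: filterS => y yP; have [jk uj] := JP y.
  exact: (yP (Ordinal jk)).
have gc : continuous g.
  by apply: subfspace_continuous => x; apply: mlim_linear; exact: hc.
exists (mkcts gc : continuousType X GV); split.
  apply: eU => x; rewrite /mkcts /= gE -[set_val _]rhoK; apply: dP => a b.
  have [jk uj] := JP x; have [_ cl] := Cnear x _ jk uj; exact: cl.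
split; first exact: gc.
move=> _ [A _ <-] x Xx; have [Xx1 _] := Xx.
pose x0 : X := SigSub (mem_set Xx1).
have /choice [dt dtP] : forall i, exists dt : 'rV[R]_m -> R, polyfun dt /\
    forall z, connected_component (X `&` @zero_stratum R V m iota k u A) x z ->
      overshoot u i (iota z) = dt (iota z) /\ (u i (iota x) <= 0 -> u i (iota z) <= 0).
  move=> i; have [ik|ki] := ltnP i k.
    by have [dt] := overshoot_polyfun iotaP u_poly Xx ik; exists dt.
  exists (fun=> 0); split; first exact: polyfun_cst.
  by move=> z _; rewrite /overshoot u_out // maxxx lexx.
set K := connected_component _ x in dtP *.
(* One index, chosen at the base point, is valid along the whole component. *)
set j := J x0; have [jk ujx] := JP x0.
pose Ct z := frame k (M ^~ z) (dt ^~ z) j.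
have CtE z : K z -> Ct (iota z) = C j (iota z).
  move=> Kz; rewrite /Ct /C; congr (frame _ _ _ _); apply/funext => i.
  by have [-> _] := (dtP i).2 z Kz.
have pCt : polymx Ct by apply: polymx_frame => i; [exact: (Mp i).1 | exact: (dtP i).1].
have pG : polymx (fun z => gram (Ct z) (E j)).
  apply: polymxD; last exact: polymx_cst.
  by apply: polymxM => //; exact: polymx_tr.
pose b z := \det (gram (Ct z) (E j)).
have pb : polyfun b by exact: polyfun_det.
(* By Cramer's rule the coordinates of the projection are these polynomials divided by [b]. *)
pose a (i : 'I_N) z := lam (Ct z *m \adj (gram (Ct z) (E j)) *m (Ct z)^T) 0 i.
have pa i : polyfun (a i).
  apply: polymx_linear; apply: polymxM; last exact: polymx_tr.
  by apply: polymxM => //; exact: polymx_adj.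
have bu z : (b z != 0) = (gram (Ct z) (E j) \in unitmx) by rewrite unitmxE unitfE.
have QG z : b z != 0 -> G (lam (range_proj (Ct z) (E j))).
  rewrite bu => Gu; apply: sym_idem_point.
    exact: (range_range_proj rhoK rho1 rhoM rho_tr (rC _ _ _) (rE _) Gu).
  by have [] := range_projP (Eproj _) (CE _ _ _) Gu.
pose U0 : set V := [set z | b (iota z) != 0].
have KX z (Kz : K z) : exists2 y : X, set_val y = z & u j (xi y) <= 0.
  have Xz : X z by case: (connected_component_sub Kz).
  exists (SigSub (mem_set Xz)) => //.
  by have [_] := (dtP j).2 z Kz; apply.
have KU : K `<=` zclosure K `&` U0.
  move=> z Kz; split; first by move=> Z [_]; apply.
  have [y yz uy] := KX z Kz.
  by rewrite /U0 /= bu CtE // -yz; exact: Cu.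
have F0 (z : subfspace (zclosure K `&` U0)) :
    G (lam (range_proj (Ct (iota (set_val z))) (E j))).
  by apply: QG; have [] := set_valP z.
pose F (z : subfspace (zclosure K `&` U0)) : GV := SigSub (mem_set (F0 z)).
exists U0, F; split => //.
- exact: (zopen_neq0 iotaP pb).
- apply: (rational_morphism iotaP pb pa) => z.
  have bz : b (iota (set_val z)) != 0 by have [] := set_valP z.
  split=> // i; have Gu : gram (Ct (iota (set_val z))) (E j) \in unitmx by rewrite -bu.
  have -> : set_val (F z) = lam (range_proj (Ct (iota (set_val z))) (E j)) by [].
  rewrite /a /range_proj /invmx Gu.
  by rewrite -scalemxAr -scalemxAl linearZ mxE mulrC.
move=> y z zy; apply: val_inj => /=; have Ky : K (set_val y) by exact: set_valP.
have uy : u j (iota (set_val y)) <= 0.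
  by have [_] := (dtP j).2 _ Ky; apply; exact: ujx.
congr (lam _); rewrite zy CtE //; symmetry; exact: hE.
Qed.

End Assembly.

Theorem theorem1p4 (R : realType) (k : base_field) (V : fspace R)
    (hV : real_algebraic_variety V) (X : set V)
    (cX : compact X) (lcX : locally_contractible R X) :
  exists strata : set (set V), stratification strata /\
    forall n : nat, (0 < n)%N ->
      forall (f : cmaps X (grassmannian R k n))
             (N : set (cmaps X (grassmannian R k n))),
        nbhs f N ->
        exists g : cmaps X (grassmannian R k n),
          N g /\ piecewise_regular strata (g : X -> grassmannian R k n).
Proof.
have [m [iota iotaP]] := variety_coordinates hV.
have cxi := restrict_coord_continuous iotaP (X := X).
have [K [u [pu u0 uc uct]]] := contractible_cover (compact_set_type cX) cxi
  (restrict_coord_inj iotaP) lcX.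
(* The polynomials [u] depend on [X] only, so the strata are fixed before [n] and [f] are given. *)
exists (range (@zero_stratum R V m iota K u)); split.
  exact: zero_stratification.
move=> n _ f N fN.
have [D [rho [lam [rhoK rho1 rhoM rho_tr rhoG]]]] := grassmannian_sym_idem R k n.
exact: (piecewise_regular_approx iotaP cX pu u0 uc uct rhoK rho1 rhoM rho_tr rhoG fN).
Qed.
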